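(* The problem of computing $SPG_k(s,t)$, given a directed graph $G=(V,E)$, distinct vertices $s,t\in V$ and a positive integer $k$, is fixed-parameter tractable with parameter $k$.
   Context: For a directed graph $G=(V,E)$, a path from $x$ to $y$ is a vertex sequence $x=v_0,v_1,\dots,v_l=y$ with $(v_{i-1},v_i)\in E$ for all $i$; its length is $l$, and $V(p)$, $E(p)$ denote its vertex and edge sets. A simple path is a path with no repeated vertex. $P_k^*(s,t)$ denotes the set of simple paths from $s$ to $t$ of length at most $k$. The $k$-hop-constrained $s$-$t$ simple path graph $SPG_k(s,t)=(V^*,E^* )$ is the subgraph of $G$ with $V^*=\bigcup_{p\in P_k^*(s,t)}V(p)$ and $E^*=\bigcup_{p\in P_k^*(s,t)}E(p)$. *)

(* Defs.v *)
From mathcomp Require Import all_boot.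
Set Implicit Arguments. Unset Strict Implicit. Unset Printing Implicit Defensive.

(* A directed graph is given by a number of vertices n (vertex set           *)
(* {0,...,n-1}) and an edge list E : seq (nat * nat).                        *)

Definition edge_rel (E : seq (nat * nat)) : rel nat := fun x y => (x, y) \in E.

Definition khop_simple_path (E : seq (nat * nat)) (k s t : nat) (p : seq nat) : Prop :=
  exists q, p = s :: q /\ path (edge_rel E) s q /\ last s q = t /\
            uniq p /\ size q <= k.

Definition path_edges (p : seq nat) : seq (nat * nat) := zip p (behead p).

Definition in_SPG_V (E : seq (nat * nat)) (k s t v : nat) : Prop :=
  exists p, khop_simple_path E k s t p /\ v \in p.

Definition in_SPG_E (E : seq (nat * nat)) (k s t : nat) (e : nat * nat) : Prop :=
  exists p, khop_simple_path E k s t p /\ e \in path_edges p.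

(* Machine model: a unit-cost random access machine with addition,           *)
(* truncated subtraction, indirect addressing and conditional jumps.         *)

Inductive instr : Type :=
  | IConst of nat & nat
  | IAdd of nat & nat & nat
  | ISub of nat & nat & nat
  | ILoad of nat & nat
  | IStore of nat & nat
  | IJz of nat & nat
  | IJmp of nat
  | IHalt.

Definition program := seq instr.
Definition memory := nat -> nat.
Definition config : Type := (nat * memory)%type.

Definition upd (M : memory) (r v : nat) : memory :=
  fun x => if x == r then v else M x.

Definition step (P : program) (c : config) : option config :=
  let: (pc, M) := c in
  if pc < size P then
    match nth IHalt P pc with
    | IConst r v => Some (pc.+1, upd M r v)
    | IAdd r a b => Some (pc.+1, upd M r (M a + M b))
    | ISub r a b => Some (pc.+1, upd M r (M a - M b))
    | ILoad r a => Some (pc.+1, upd M r (M (M a)))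
    | IStore a b => Some (pc.+1, upd M (M a) (M b))
    | IJz a l => Some (if M a == 0 then l else pc.+1, M)
    | IJmp l => Some (l, M)
    | IHalt => None
    end
  else None.

Fixpoint run (P : program) (j : nat) (c : config) : option config :=
  match j with
  | 0 => Some c
  | j'.+1 => match step P c with Some c' => run P j' c' | None => None end
  end.

Definition halts_within (P : program) (T : nat) (c : config) (Mf : memory) : Prop :=
  exists j pc, j <= T /\ run P j c = Some (pc, Mf) /\ step P (pc, Mf) = None.

Definition enc_edges (E : seq (nat * nat)) : seq nat :=
  flatten [seq [:: e.1; e.2] | e <- E].

Definition init_mem (n : nat) (E : seq (nat * nat)) (s t k : nat) : memory :=
  fun a => match a with
           | 0 => n | 1 => size E | 2 => s | 3 => t | 4 => k
           | _ => nth 0 (enc_edges E) (a - 5)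
           end.

Definition output_correct (n : nat) (E : seq (nat * nat)) (s t k : nat)
    (Mf : memory) : Prop :=
  (forall v, v < n ->
     (in_SPG_V E k s t v -> Mf (5 + 2 * size E + v) = 1) /\
     (~ in_SPG_V E k s t v -> Mf (5 + 2 * size E + v) = 0)) /\
  (forall i, i < size E ->
     (in_SPG_E E k s t (nth (0, 0) E i) -> Mf (5 + 2 * size E + n + i) = 1) /\
     (~ in_SPG_E E k s t (nth (0, 0) E i) -> Mf (5 + 2 * size E + n + i) = 0)).

Definition valid_instance (n : nat) (E : seq (nat * nat)) (s t k : nat) : Prop :=
  all (fun e => (e.1 < n) && (e.2 < n)) E /\ s < n /\ t < n /\ s <> t /\ 0 < k.

Definition input_size (n : nat) (E : seq (nat * nat)) : nat := n + size E + 1.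

(* Main.v *)
(* If every vertex carries a potential in {0, ..., k}, then a walk along which the potential
   strictly decreases is automatically simple and of length at most k, so reachability from s
   and to t by such walks certifies edges of SPG_k(s,t). It remains to try so many potentials
   that every simple path with at most k edges is decreasing for one of them. The at most k + 1
   vertices of a path are separated by some k bit positions; these k positions together with a
   table of 2^k potentials, indexed by the values of the k bits, determine a potential. Writing
   all this as K = k + 2^k digits in a base B = O(k + log n) gives B^K <= K^K 2^B = g(k) n
   guesses. The algorithm is written in a language of bounded loops and compiled to the RAM;
   as all loops range over variables that their bodies do not assign, a common bound X on
   these variables makes the running time polynomial in X. *)

Require Import Defs.
From mathcomp Require Import all_boot zify.
Set Implicit Arguments. Unset Strict Implicit. Unset Printing Implicit Defensive.

(** A walk from s to u and a walk from w to t may meet, so gluing them at an edge (u, w) need not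
    give a simple path. If both walks and the edge descend for one common potential, they cannot
    meet: every potential on the first walk exceeds every one on the second. Digits serve both as
    bit positions of vertex names, which asks for n <= 2 ^ B, and as values in {0, ..., k}, which
    asks for k < B. One base for both makes a guess a single number, and trying all guesses is one
    bounded loop; no hash family has to be constructed. A wrong guess is harmless, since any table
    gives some potential and can only certify true edges. The RAM neither multiplies nor divides:
    powers are built by repeated addition and digits are extracted by repeated subtraction, at a
    cost polynomial in B ^ K, which the bound on B ^ K can absorb. *)

(** * A language of bounded loops and its frame properties *)

Inductive stmt : Type :=
  | SConst of nat & nat
  | SAdd of nat & nat & nat
  | SSub of nat & nat & nat
  | SLoad of nat & nat
  | SStore of nat & nat
  | SSeq of stmt & stmt
  | SIf of nat & stmt
  | SFor of nat & nat & stmt.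

(* Variables and heap. Heap accesses at or beyond address [b] are skipped, which keeps the
   compiled code away from the memory cells that hold the variables. *)
Definition state : Type := (memory * memory)%type.

(** The counter descends, so one variable is both the index seen by the body and the number of
    iterations left. Invariants are accordingly indexed by what remains and are wanted at 0. *)
Fixpoint loop (body : state -> state) (c j : nat) (sg : state) : state :=
  if j is j'.+1 then loop body c j' (body (upd sg.1 c j', sg.2)) else sg.

Fixpoint eval (b : nat) (s : stmt) (sg : state) : state :=
  let: (v, h) := sg in
  match s with
  | SConst x c => (upd v x c, h)
  | SAdd x y z => (upd v x (v y + v z), h)
  | SSub x y z => (upd v x (v y - v z), h)
  | SLoad x y => if 5 + v y < b then (upd v x (h (v y)), h) else (v, h)
  | SStore x y => if 5 + v x < b then (v, upd h (v x) (v y)) else (v, h)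
  | SSeq s1 s2 => eval b s2 (eval b s1 (v, h))
  | SIf x s1 => if v x == 0 then (v, h) else eval b s1 (v, h)
  | SFor c x s1 => loop (eval b s1) c (v x) (upd v c (v x), h)
  end.

Fixpoint writes (s : stmt) : seq nat :=
  match s with
  | SConst x _ | SAdd x _ _ | SSub x _ _ | SLoad x _ => [:: x]
  | SStore _ _ => [::]
  | SSeq s1 s2 => writes s1 ++ writes s2
  | SIf _ s1 => writes s1
  | SFor c _ s1 => c :: writes s1
  end.

Fixpoint heap_free (s : stmt) : bool :=
  match s with
  | SStore _ _ => false
  | SSeq s1 s2 => heap_free s1 && heap_free s2
  | SIf _ s1 | SFor _ _ s1 => heap_free s1
  | _ => true
  end.

(** The body may not assign the counter because the compiled loop reads the remaining count back
    from it, whereas [loop] keeps that count outside the state. *)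
Fixpoint loops_over (xs : seq nat) (s : stmt) : bool :=
  match s with
  | SConst x _ | SAdd x _ _ | SSub x _ _ | SLoad x _ => x \notin xs
  | SStore _ _ => true
  | SSeq s1 s2 => loops_over xs s1 && loops_over xs s2
  | SIf _ s1 => loops_over xs s1
  | SFor c x s1 => [&& x \in xs, c \notin xs, c \notin writes s1 & loops_over xs s1]
  end.

Lemma loop_ind (I : nat -> state -> Prop) body c x sg :
  I x (upd sg.1 c x, sg.2) ->
  (forall j tau, j < x -> I j.+1 tau -> I j (body (upd tau.1 c j, tau.2))) ->
  I 0 (loop body c x (upd sg.1 c x, sg.2)).
Proof.
move: (upd _ _ _, _) => tau.
elim: x tau => [|x IH] tau //= I1 Istep.
by apply: IH; [exact: Istep | move=> j ? jx; apply: Istep; apply: ltnW].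
Qed.

Lemma eval_for (I : nat -> state -> Prop) b c x s sg :
  I (sg.1 x) (upd sg.1 c (sg.1 x), sg.2) ->
  (forall j tau, j < sg.1 x -> I j.+1 tau -> I j (eval b s (upd tau.1 c j, tau.2))) ->
  I 0 (eval b (SFor c x s) sg).
Proof. case: sg => v h /=; exact: (@loop_ind I (eval b s) c (v x) (v, h)). Qed.

Lemma updE M r v x : upd M r v x = if x == r then v else M x.
Proof. by []. Qed.

Lemma eval_frame b s sg x : x \notin writes s -> (eval b s sg).1 x = sg.1 x.
Proof.
elim: s sg => [r c|r y z|r y z|r y|r y|s1 IH1 s2 IH2|r s IH|c r s IH] [v h] /=;
  rewrite ?inE ?mem_cat ?negb_or ?updE; try by move=> /negPf ->.
- by case: ifP => //= _ /negPf; rewrite updE => ->.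
- by case: ifP.
- by case/andP=> ? ?; rewrite IH2 // IH1.
- by move=> xs; case: eqP => // _; rewrite IH.
- case/andP=> xc xs.
  apply: (@loop_ind (fun _ tau => tau.1 x = v x) (eval b s) c (v r) (v, h)).
    by rewrite /= updE (negPf xc).
  by move=> j tau _ <-; rewrite IH //= updE (negPf xc).
Qed.

Lemma eval_heap_free b s sg : heap_free s -> (eval b s sg).2 = sg.2.
Proof.
elim: s sg => [r c|r y z|r y z|r y|r y|s1 IH1 s2 IH2|r s IH|c r s IH] [v h] //=.
- by case: ifP.
- by case/andP=> ? ?; rewrite IH2 // IH1.
- by move=> hs; case: eqP => // _; rewrite IH.
- move=> hs.
  apply: (@loop_ind (fun _ tau => tau.2 = h) (eval b s) c (v r) (v, h)) => //.
  by move=> j tau _ <-; rewrite IH.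
Qed.

Lemma loops_over_writes xs s x : loops_over xs s -> x \in xs -> x \notin writes s.
Proof.
elim: s => [r c|r y z|r y z|r y|r y|s1 IH1 s2 IH2|r s IH|c r s IH] //=;
  rewrite ?inE ?mem_cat ?negb_or.
- by move=> rx xx; apply: contraNneq rx => <-.
- by move=> rx xx; apply: contraNneq rx => <-.
- by move=> rx xx; apply: contraNneq rx => <-.
- by move=> rx xx; apply: contraNneq rx => <-.
- by case/andP=> ? ? ?; rewrite IH1 ?IH2.
- case/and4P=> _ cx _ lx xx; rewrite IH // andbT.
  by apply: contraNneq cx => <-.
Qed.

(** * Compilation *)

Definition getv r x := [:: IConst 3 x; IAdd 3 2 3; ILoad r 3].
Definition putv x r := [:: IConst 3 x; IAdd 3 2 3; IStore 3 r].

(** Jump targets are absolute, hence the start address [l]. Loads and stores are guarded by the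
    truncated difference b - (5 + address), which vanishes exactly when the access must be
    skipped. *)
Fixpoint compile (l : nat) (s : stmt) : seq instr :=
  match s with
  | SConst x c => IConst 0 c :: putv x 0
  | SAdd x y z => getv 0 y ++ getv 1 z ++ IAdd 0 0 1 :: putv x 0
  | SSub x y z => getv 0 y ++ getv 1 z ++ ISub 0 0 1 :: putv x 0
  | SLoad x y =>
      (getv 0 y ++ [:: IConst 4 5; IAdd 0 4 0; ISub 4 2 0]) ++
      IJz 4 (l + 11) :: ILoad 0 0 :: putv x 0
  | SStore x y =>
      (getv 0 x ++ [:: IConst 4 5; IAdd 0 4 0; ISub 4 2 0]) ++
      IJz 4 (l + 11) :: getv 1 y ++ [:: IStore 0 1]
  | SSeq s1 s2 => let c1 := compile l s1 in c1 ++ compile (l + size c1) s2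
  | SIf x s1 =>
      let c1 := compile (l + 4) s1 in getv 0 x ++ IJz 0 (l + 4 + size c1) :: c1
  | SFor c x s1 =>
      let c1 := compile (l + 15) s1 in
      (getv 0 x ++ putv c 0) ++ getv 0 c ++ IJz 0 (l + 16 + size c1) ::
      [:: IConst 1 1, ISub 0 0 1 & putv c 0] ++ c1 ++ [:: IJmp (l + 6)]
  end.

Definition code_at (P : program) l (cs : seq instr) :=
  exists pre post, P = pre ++ cs ++ post /\ size pre = l.

Lemma code_at_self P : code_at P 0 P.
Proof. by exists [::], [::]; rewrite cats0. Qed.

Lemma code_at_cat P l c1 c2 :
  code_at P l (c1 ++ c2) -> code_at P l c1 /\ code_at P (l + size c1) c2.
Proof.
case=> pre [post [-> <-]]; split.
  by exists pre, (c2 ++ post); rewrite -!catA.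
by exists (pre ++ c1), post; rewrite size_cat -!catA.
Qed.

Lemma code_at_cons P l i cs :
  code_at P l (i :: cs) -> code_at P l [:: i] /\ code_at P l.+1 cs.
Proof. by rewrite -cat1s => /code_at_cat [? /=]; rewrite addn1. Qed.

Lemma code_at1 P l i : code_at P l [:: i] -> l < size P /\ nth IHalt P l = i.
Proof.
case=> pre [post [-> <-]]; rewrite nth_cat ltnn subnn /=; split => //.
by rewrite size_cat /= -addn1 leq_add2l.
Qed.

Definition exec1 (M : memory) (i : instr) : memory :=
  match i with
  | IConst r v => upd M r v
  | IAdd r a b => upd M r (M a + M b)
  | ISub r a b => upd M r (M a - M b)
  | ILoad r a => upd M r (M (M a))
  | IStore a b => upd M (M a) (M b)
  | _ => M
  end.

Definition straight (i : instr) : bool :=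
  match i with IJz _ _ | IJmp _ | IHalt => false | _ => true end.

Definition reach P T (c c' : config) := exists2 j, j <= T & run P j c = Some c'.

Lemma run_add P i j c c' : run P i c = Some c' -> run P (i + j) c = run P j c'.
Proof.
elim: i c => [|i IH] c /=; first by case=> ->.
by case: (step P c) => // c1; apply: IH.
Qed.

Lemma reach_trans P T1 T2 c1 c2 c3 :
  reach P T1 c1 c2 -> reach P T2 c2 c3 -> reach P (T1 + T2) c1 c3.
Proof.
by case=> i iT ri [j jT rj]; exists (i + j); rewrite ?leq_add // (run_add _ ri).
Qed.

Lemma reach_le P T1 T2 c1 c2 : T1 <= T2 -> reach P T1 c1 c2 -> reach P T2 c1 c2.
Proof. by move=> le [j jT r]; exists j => //; apply: leq_trans le. Qed.

Lemma reach_refl P T c : reach P T c c.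
Proof. by exists 0. Qed.

Lemma reach_straight P l cs M : code_at P l cs -> all straight cs ->
  reach P (size cs) (l, M) (l + size cs, foldl exec1 M cs).
Proof.
elim: cs l M => [|i cs IH] l M /=; first by rewrite addn0 => *; apply: reach_refl.
case/code_at_cons => /code_at1 [lP iP] cP /andP [si scs].
rewrite -addn1 addnC addnS -addSn; apply: reach_trans (IH _ _ cP scs).
exists 1 => //=; rewrite lP iP.
by case: i si {iP}.
Qed.

Lemma reach_step P l i M : code_at P l [:: i] -> straight i ->
  reach P 1 (l, M) (l.+1, exec1 M i).
Proof.
by move=> cP si; have := reach_straight M cP; rewrite /= andbT addn1; apply.
Qed.

Lemma reach_jz P l r l' M : code_at P l [:: IJz r l'] ->
  reach P 1 (l, M) (if M r == 0 then l' else l.+1, M).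
Proof. by case/code_at1 => lP iP; exists 1; rewrite //= lP iP. Qed.

Lemma reach_jmp P l l' M : code_at P l [:: IJmp l'] -> reach P 1 (l, M) (l', M).
Proof. by case/code_at1 => lP iP; exists 1; rewrite //= lP iP. Qed.

(* Variables live at [b, b + 1, ...] with [b] kept in register 2; heap cell [a] is
   physical address [5 + a], and registers 0, 1, 3, 4 are scratch. *)
Definition represents b (M : memory) (sg : state) :=
  [/\ M 2 = b, forall i, M (b + i) = sg.1 i & forall a, 5 + a < b -> M (5 + a) = sg.2 a].

(** A guarded load or store is the longest basic statement, with 11 instructions. A loop spends 6
    steps on setup and 4 on its last test, and 10 around each run of the body. *)
Fixpoint time (X : nat) (s : stmt) : nat :=
  match s with
  | SSeq s1 s2 => time X s1 + time X s2
  | SIf _ s1 => 4 + time X s1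
  | SFor _ _ s1 => 10 + X * (10 + time X s1)
  | _ => 11
  end.

Lemma getv_spec P b l M sg r x : 5 <= b ->
  code_at P l (getv r x) -> represents b M sg -> r \in [:: 0; 1; 4] ->
  exists M', [/\ reach P 3 (l, M) (l + 3, M'), represents b M' sg, M' r = sg.1 x &
     forall r', r' \in [:: 0; 1; 4] -> r' != r -> M' r' = M r'].
Proof.
case: b => [|[|[|[|[|b]]]]] // _ cP [M2 Mv Mh] rr.
exists (foldl exec1 M (getv r x)); split.
- exact: (reach_straight M cP).
- split=> [|i|a ab] /=; rewrite !updE /= M2 ?updE /=.
  + by move: rr; rewrite !inE => /or3P [] /eqP -> /=.
  + by move: rr; rewrite !inE => /or3P [] /eqP -> /=; rewrite -Mv.
  + by move: rr; rewrite !inE => /or3P [] /eqP -> /=; rewrite -Mh.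
- by rewrite /= !updE /= M2 eqxx /= Mv.
- by move=> r' r'r /negPf ne; rewrite /= updE ne; move: r'r; rewrite !inE => /or3P [] /eqP ->.
Qed.

Lemma putv_spec P b l M sg r x : 5 <= b ->
  code_at P l (putv x r) -> represents b M sg -> r \in [:: 0; 1; 4] ->
  exists2 M', reach P 3 (l, M) (l + 3, M') & represents b M' (upd sg.1 x (M r), sg.2).
Proof.
case: b => [|[|[|[|[|b]]]]] // _ cP [M2 Mv Mh] rr.
exists (foldl exec1 M (putv x r)); first exact: (reach_straight M cP).
have E : upd (upd M 3 x) 3 (upd M 3 x 2 + upd M 3 x 3) r = M r.
  by move: rr; rewrite !inE => /or3P [] /eqP ->.
rewrite /= E; split=> [|i|a ab] /=; rewrite !updE /= M2 ?updE /= ?M2 //.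
- rewrite !addSn /= !eqSS eqn_add2l; case: eqP => // _; exact: Mv.
- case: eqP => [e|_]; last exact: Mh.
  by move: ab; rewrite e; lia.
Qed.

(** The list [xs] contains every loop bound and no assigned variable, so a bound on it in the
    initial state limits every iteration count met during the run. *)
Lemma compile_correct P b X xs s : 5 <= b -> loops_over xs s ->
  forall l M sg, code_at P l (compile l s) -> represents b M sg ->
  (forall x, x \in xs -> sg.1 x <= X) ->
  exists2 M', reach P (time X s) (l, M) (l + size (compile l s), M') &
    represents b M' (eval b s sg).
Proof.
move=> b5.
have scratch M sg r v : r \in [:: 0; 1; 4] -> represents b M sg -> represents b (upd M r v) sg.
  case: b b5 => [|[|[|[|[|b']]]]] // _ rr [M2 Mv Mh].
  split=> [|i|a ab] /=; rewrite ?updE -?Mv -?Mh //=;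
    by move: rr; rewrite !inE => /or3P [] /eqP -> /=.
have addr l M sg y : M 0 = y -> code_at P l [:: IConst 4 5; IAdd 0 4 0; ISub 4 2 0] ->
    represents b M sg ->
    exists M', [/\ reach P 3 (l, M) (l + 3, M'), represents b M' sg, M' 0 = 5 + y,
      M' 1 = M 1 & M' 4 = b - (5 + y)].
  move=> <- cP rM; exists (foldl exec1 M [:: IConst 4 5; IAdd 0 4 0; ISub 4 2 0]).
  split=> //; first exact: (reach_straight M cP).
    by rewrite /=; do 3 apply: (scratch) => //.
  by case: rM => M2 _ _; rewrite /= !updE /= M2.
elim: s => [r c|r y z|r y z|r y|r y|s1 IH1 s2 IH2|r s IH|c r s IH] /= lo l M [v h] cP rM vX.
- case/code_at_cons: cP => c1 c2.
  have [M' r1 rM'] := putv_spec b5 c2 (scratch _ _ 0 c isT rM) isT.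
  exists M'; last by rewrite /= updE /= in rM'.
  apply: (@reach_le _ (1 + 3)) => //; apply: reach_trans (reach_step M c1 isT) _.
  by rewrite addnS -addSn.
- have [/= c1 /(@code_at_cat _ _ (getv 1 z)) [/= c2 /code_at_cons [c3 c4]]] :=
    code_at_cat (cP : code_at P l (getv 0 y ++ getv 1 z ++ _)).
  have [M1 [r1 rM1 e1 _]] := getv_spec b5 c1 rM isT.
  have [M2 [r2 rM2 e2 k2]] := getv_spec b5 c2 rM1 isT.
  have [M' r3 rM'] := putv_spec b5 c4 (scratch _ _ 0 (M2 0 + M2 1) isT rM2) isT.
  exists M'; last by move: rM'; rewrite /= updE /= e2 k2 // e1.
  apply: (@reach_le _ (3 + (3 + (1 + 3)))) => //.
  apply: reach_trans r1 _; apply: reach_trans r2 _.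
  apply: reach_trans (reach_step M2 c3 isT) _.
  by rewrite (_ : l + 10 = (l + 3 + 3).+1 + 3) //; lia.
- have [/= c1 /(@code_at_cat _ _ (getv 1 z)) [/= c2 /code_at_cons [c3 c4]]] :=
    code_at_cat (cP : code_at P l (getv 0 y ++ getv 1 z ++ _)).
  have [M1 [r1 rM1 e1 _]] := getv_spec b5 c1 rM isT.
  have [M2 [r2 rM2 e2 k2]] := getv_spec b5 c2 rM1 isT.
  have [M' r3 rM'] := putv_spec b5 c4 (scratch _ _ 0 (M2 0 - M2 1) isT rM2) isT.
  exists M'; last by move: rM'; rewrite /= updE /= e2 k2 // e1.
  apply: (@reach_le _ (3 + (3 + (1 + 3)))) => //.
  apply: reach_trans r1 _; apply: reach_trans r2 _.
  apply: reach_trans (reach_step M2 c3 isT) _.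
  by rewrite (_ : l + 10 = (l + 3 + 3).+1 + 3) //; lia.
- have [/code_at_cat [/= c1 c2] /code_at_cons [c3 /code_at_cons [c4 c5]]] :=
    code_at_cat (cP : code_at P l ((getv 0 y ++ [:: _; _; _]) ++ _)).
  have [M1 [r1 rM1 e1 _]] := getv_spec b5 c1 rM isT.
  have [M2 [r2 rM2 e2 _ e4]] := addr _ _ _ _ e1 c2 rM1.
  have r3 := reach_jz M2 c3; rewrite e4 subn_eq0 leqNgt /= in r3.
  rewrite -(addnA l 3 3) in r2; have {}r3 := reach_trans r1 (reach_trans r2 r3).
  have sz : (l + 6).+2 + 3 = l + 11 by lia.
  rewrite /= in e1; case yb: (5 + _ < b) r3 => /= r3; last first.
    by exists M2 => //; apply: reach_le r3.
  have r4 := reach_trans r3 (reach_step M2 c4 isT).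
  have [M' r5 rM'] := putv_spec b5 c5 (scratch _ _ 0 (M2 (M2 0)) isT rM2) isT.
  exists M'.
    by move: (reach_trans r4 r5); rewrite -sz.
  by move: rM'; rewrite /= updE /= e2; case: rM2 => _ _ ->.
- have [/code_at_cat [/= c1 c2] /code_at_cons [c3 /(@code_at_cat _ _ (getv 1 y)) [/= c4 c5]]] :=
    code_at_cat (cP : code_at P l ((getv 0 r ++ [:: _; _; _]) ++ _)).
  have [M1 [r1 rM1 e1 _]] := getv_spec b5 c1 rM isT.
  have [M2 [r2 rM2 e2 _ e4]] := addr _ _ _ _ e1 c2 rM1.
  have r3 := reach_jz M2 c3; rewrite e4 subn_eq0 leqNgt /= in r3.
  rewrite -(addnA l 3 3) in r2; have {}r3 := reach_trans r1 (reach_trans r2 r3).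
  have sz : ((l + 6).+1 + 3).+1 = l + 11 by lia.
  rewrite /= in e1; case yb: (5 + _ < b) r3 => /= r3; last first.
    by exists M2 => //; apply: reach_le r3.
  have [M3 [r4 rM3 f1 k0]] := getv_spec b5 c4 rM2 isT.
  exists (upd M3 (5 + v r) (v y)).
    move: (reach_trans r3 (reach_trans r4 (reach_step M3 c5 isT))).
    by rewrite -sz /= k0 // e2 f1.
  case: rM3 => N2 Nv Nh; split=> [|i|a ab] /=; rewrite updE.
  + by rewrite N2.
  + by rewrite ifF ?Nv //; apply/eqP; lia.
  + by rewrite eqn_add2l Nh.
- case/andP: lo => lo1 lo2; case: (code_at_cat cP) => c1 c2.
  have [M1 r1 rM1] := IH1 lo1 _ _ _ c1 rM vX.
  have [|M2 r2 rM2] := IH2 lo2 _ _ _ c2 rM1.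
    by move=> x xx; rewrite eval_frame ?vX // (loops_over_writes lo1).
  by exists M2 => //; rewrite size_cat addnA; apply: reach_trans r1 r2.
- have [c1 /code_at_cons [c2 c3]] := code_at_cat (cP : code_at P l (getv 0 r ++ _)).
  have [M1 [r1 rM1 e1 _]] := getv_spec b5 c1 rM isT.
  have r2 := reach_trans r1 (reach_jz M1 c2); rewrite e1 /= in r2.
  have sz : l + (size (compile (l + 4) s)).+4 = l + 4 + size (compile (l + 4) s) by lia.
  rewrite sz; case: ifP r2 => v0 r2.
    by exists M1 => //; apply: reach_le r2; rewrite -[X in X <= _]addn0 leq_add.
  rewrite /= -addnS in c3 r2.
  have [M2 r3 rM2] := IH lo _ _ _ c3 rM1 vX.
  by exists M2 => //; apply: reach_trans r2 r3.
- case/and4P: lo => rx cx cs lo.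
  set c1 := compile _ s in cP *.
  have [/code_at_cat [/= a1 a2]] :=
    code_at_cat (cP : code_at P l ((getv 0 r ++ putv c 0) ++ _)).
  case/(@code_at_cat _ _ (getv 0 c)) => /= a3 /code_at_cons [a4].
  case/(@code_at_cat _ _ [:: IConst 1 1; ISub 0 0 1]) => /= a5.
  case/(@code_at_cat _ _ (putv c 0)) => /= a6 /code_at_cat [a7 a8].
  have [M1 [r1 rM1 e1 _]] := getv_spec b5 a1 rM isT.
  have [M2 r2 rM2] := putv_spec b5 a2 rM1 isT.
  rewrite e1 -(addnA l 3 3) in rM2 r2.
  have {r1} r2 := reach_trans r1 r2.
  have sz : l + (size (c1 ++ [:: IJmp (l + 6)])).+3.+4.+4.+4 = l + 16 + size c1.
    by rewrite size_cat /=; lia.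
  rewrite sz /= in rM2 *.
  have vrX : v r <= X by apply: vX.
  (* Induction on the iterations left, which the counter cell holds at the loop head; the bounds on
     [xs] must travel along because the body changes the state. *)
  suff main j N tau : represents b N tau -> tau.1 c = j ->
      (forall x, x \in xs -> tau.1 x <= X) ->
      exists2 M', reach P (j * (10 + time X s) + 4) (l + 6, N) (l + 16 + size c1, M') &
        represents b M' (loop (eval b s) c j tau).
    have [|x xx|M' r3 rM'] := main (v r) _ _ rM2.
    - by rewrite /= updE eqxx.
    - by rewrite /= updE; case: eqP => [e|_]; [rewrite -e xx in cx | apply: vX].
    exists M' => //; apply: reach_le (reach_trans r2 r3).
    by rewrite [3 + 3]/= [_ + 4]addnC addnA leq_add2l leq_mul2r vrX orbT.
  elim: j N tau => [|j IHj] N tau rN tc tX.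
    have [N1 [q1 rN1 f1 _]] := getv_spec b5 a3 rN isT.
    have := reach_trans q1 (reach_jz N1 a4); rewrite f1 tc /= => q2.
    by exists N1 => //; apply: reach_le q2.
  have [N1 [q1 rN1 f1 _]] := getv_spec b5 a3 rN isT.
  have := reach_trans q1 (reach_jz N1 a4); rewrite f1 tc /= => q2.
  have q3 := reach_trans q2 (reach_straight N1 a5 isT).
  have rN2 : represents b (foldl exec1 N1 [:: IConst 1 1; ISub 0 0 1]) tau.
    by rewrite /=; do 2 apply: (scratch) => //.
  have [N3 q4 rN3] := putv_spec b5 a6 rN2 isT.
  rewrite /= !updE /= f1 tc subn1 /= in rN3.
  have {q2 q3} q4 := reach_trans q3 q4.
  have E : (l + 6 + 3).+1 + 2 + 3 = l + 15 by lia.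
  rewrite E in a7 a8 q4.
  have x3X x : x \in xs -> upd tau.1 c j x <= X.
    by rewrite updE; case: eqP => [-> xx|_]; [rewrite xx in cx | apply: tX].
  have [N4 q5 rN4] := IH lo _ _ _ a7 rN3 x3X.
  have q6 := reach_trans q4 (reach_trans q5 (reach_jmp N4 a8)).
  have [|x xx|M' q7 rM'] := IHj _ _ rN4.
  - by rewrite eval_frame //= updE eqxx.
  - by rewrite eval_frame ?x3X // (loops_over_writes lo).
  exists M' => //; apply: reach_le (reach_trans q6 q7).
  by rewrite /=; lia.
Qed.

(** * Guessing potentials *)

Definition digit d i a := a %/ d ^ i %% d.

Lemma digitS d i a : digit d i.+1 a = digit d i (a %/ d).
Proof. by rewrite /digit expnS divnMA. Qed.

Lemma ltn_digit d i a : 0 < d -> digit d i a < d.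
Proof. exact: ltn_pmod. Qed.

Lemma digit_repr B ds : all (fun d => d < B) ds ->
  exists2 N, N < B ^ size ds & forall i, i < size ds -> digit B i N = nth 0 ds i.
Proof.
elim: ds => [_|d ds IH /= /andP [dB /IH [N NB Ni]]]; first by exists 0.
exists (N * B + d); first by rewrite expnS; nia.
have Bgt0 : 0 < B by apply: leq_ltn_trans dB.
case=> [_|i ids]; first by rewrite /digit expn0 divn1 modnMDl modn_small.
by rewrite digitS divnMDl // divn_small // addn0 Ni.
Qed.

Lemma digit2_neq B x y : x < 2 ^ B -> y < 2 ^ B -> x != y ->
  exists2 j, j < B & digit 2 j x != digit 2 j y.
Proof.
elim: B x y => [|B IH] x y; first by rewrite expn0 !ltnS !leqn0 => /eqP -> /eqP ->.
rewrite expnS => xB yB xy.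
have [e|ne] := eqVneq (x %% 2) (y %% 2); last first.
  by exists 0 => //; rewrite /digit !divn1.
have [| | |j jB jne] := IH (x %/ 2) (y %/ 2).
- by rewrite ltn_divLR // mulnC.
- by rewrite ltn_divLR // mulnC.
- by apply: contraNneq xy => e'; rewrite (divn_eq x 2) (divn_eq y 2) e e'.
by exists j.+1; rewrite // !digitS.
Qed.

(** The head of [w] gives the least significant bit, so that a loop with descending counter
    evaluates the hash by Horner's rule. *)
Fixpoint bit_hash (w : seq nat) (v : nat) : nat :=
  if w is j :: w' then bit_hash w' v + bit_hash w' v + digit 2 j v else 0.

Lemma bit_hash_lt w v : bit_hash w v < 2 ^ size w.
Proof. by elim: w => //= j w IH; have := ltn_digit j v (isT : 0 < 2); rewrite expnS; lia. Qed.

Lemma bit_hash_cons j w x y : bit_hash (j :: w) x = bit_hash (j :: w) y ->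
  bit_hash w x = bit_hash w y /\ digit 2 j x = digit 2 j y.
Proof.
have := ltn_digit j x (isT : 0 < 2); have := ltn_digit j y (isT : 0 < 2).
by rewrite /=; lia.
Qed.

(* Adding one vertex creates at most one collision, which one more bit resolves. *)
Lemma bit_hash_separates B k p : 0 < B -> uniq p -> size p <= k.+1 ->
  all (fun v => v < 2 ^ B) p ->
  exists w, [/\ size w = k, all (fun j => j < B) w & {in p &, injective (bit_hash w)}].
Proof.
move=> B0; elim: k p => [|k IH] [|x p] //=.
- by exists [::].
- by move=> _; rewrite ltnS leqn0 size_eq0 => /eqP -> _; exists [::]; split=> // a b;
    rewrite !inE => /eqP -> /eqP ->.
- by move=> _ _ _; exists (nseq k.+1 0); rewrite size_nseq all_nseq B0; split.
case/andP=> xp up sp /andP [xB pB].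
have [w [sw wB wi]] := IH p up sp pB.
have inj j : {in p &, injective (bit_hash (j :: w))}.
  by move=> a b ap bp /bit_hash_cons [+ _]; apply: wi.
suff [j jB jx] : exists2 j, j < B & forall y, y \in p -> bit_hash (j :: w) x != bit_hash (j :: w) y.
  exists (j :: w); split; rewrite /= ?sw ?jB // => a b; rewrite !inE.
  case/predU1P=> [->|ap] /predU1P [->|bp] // e; last exact: inj e.
    by case/eqP: (jx b bp).
  by case/eqP: (jx a ap); apply: esym.
have [/hasP [y yp /eqP exy]|/hasPn no] := boolP (has (fun y => bit_hash w x == bit_hash w y) p).
- have yB : y < 2 ^ B := allP pB _ yp.
  have [|j jB ne] := digit2_neq xB yB; first by apply: contraNneq xp => ->.
  (* If x still collided with some z, the old hash of z would be that of x, hence that of y;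
     injectivity on p gives z = y, against the choice of j. *)
  exists j => // z zp; apply: contraNneq ne => /bit_hash_cons [e1 e2].
  by rewrite e2 (wi y z) // -exy.
- by exists 0 => // y yp; apply: contraNneq (no y yp) => /bit_hash_cons [-> _].
Qed.

(* The level of [v] in the guess encoded by [N]: the first [k] base-[B] digits of [N] are bit
   positions, and the hash of [v] at them selects a further digit of [N]. *)
Definition level B k N v :=
  digit B (k + bit_hash (mkseq (fun j => digit B j N) k) v) N.

Lemma level_complete B k p : k < B -> uniq p -> size p <= k.+1 ->
  all (fun v => v < 2 ^ B) p ->
  exists2 N, N < B ^ (k + 2 ^ k) &
    forall i, i < size p -> level B k N (nth 0 p i) = i.
Proof.
move=> kB up sp pB; have [w [sw wB wi]] := bit_hash_separates (leq_trans (ltn0Sn _) kB) up sp pB.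
(* Entry a is the place in p of the vertex with hash a. For a hash that no vertex of p has, [index]
   returns [size p], possibly k + 1; the minimum with k keeps all digits below B. *)
pose tb := mkseq (fun a => minn k (index a (map (bit_hash w) p))) (2 ^ k).
have [|N] := @digit_repr B (w ++ tb).
  rewrite all_cat wB; apply/allP => d /mapP [a _ ->].
  by apply: leq_ltn_trans (geq_minl _ _) kB.
rewrite size_cat sw size_mkseq => NB Ni; exists N => // i ip.
rewrite /level (_ : mkseq _ k = w); last first.
  apply: (@eq_from_nth _ 0); rewrite size_mkseq // => j jk.
  by rewrite nth_mkseq // Ni ?nth_cat ?sw ?jk // ltn_addr.
have hw : bit_hash w (nth 0 p i) < 2 ^ k by rewrite -sw bit_hash_lt.
rewrite Ni ?ltn_add2l // nth_cat sw ltnNge leq_addr /= addKn nth_mkseq //.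
rewrite -(nth_map 0 0) // index_uniq ?size_map //; last by rewrite map_inj_in_uniq.
by apply/minn_idPr; rewrite -ltnS; apply: leq_trans sp.
Qed.

(** With q the quotient of x by K one has x <= K * 2 ^ q, and the K-th power of 2 ^ q is at most 2 ^
    x. *)
Lemma exp_le_fpt x K : x ^ K <= K ^ K * 2 ^ x.
Proof.
case: K => [|K]; first by rewrite !expn0 mul1n expn_gt0.
set q := x %/ K.+1.
have xq : x <= K.+1 * 2 ^ q.
  rewrite (divn_eq x K.+1) -/q; have := ltn_expl q (ltnSn 1).
  have : x %% K.+1 < K.+1 by rewrite ltn_mod.
  by nia.
apply: leq_trans (_ : (K.+1 * 2 ^ q) ^ K.+1 <= _); first by rewrite leq_exp2r.
by rewrite expnMn -expnM leq_mul2l leq_exp2l // leq_divM orbT.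
Qed.

(** * The algorithm *)

(** Each step also learns that variables the loop does not write, and the heap if the body is heap
    free, are as they were at the start; an invariant need only state what changes. *)
Lemma for_rule (I : nat -> state -> Prop) b c x s sg :
  I (sg.1 x) (upd sg.1 c (sg.1 x), sg.2) ->
  (forall j tau, j < sg.1 x ->
     (forall y, y \notin c :: writes s -> tau.1 y = sg.1 y) ->
     (heap_free s -> tau.2 = sg.2) ->
     I j.+1 tau -> I j (eval b s (upd tau.1 c j, tau.2))) ->
  I 0 (eval b (SFor c x s) sg).
Proof.
move=> I1 Istep.
pose J j tau := [/\ I j tau, forall y, y \notin c :: writes s -> tau.1 y = sg.1 y &
  (heap_free s -> tau.2 = sg.2)].
suff [] : J 0 (eval b (SFor c x s) sg) by [].
apply: eval_for; rewrite /J.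
  by split=> // y; rewrite inE negb_or /= updE => /andP [/negPf ->].
move=> j tau jx [Ij fr hf]; split; first exact: Istep.
  move=> y ys; rewrite eval_frame.
    by rewrite /= updE ifN ?fr //; move: ys; rewrite inE negb_or => /andP [].
  by move: ys; rewrite inE negb_or => /andP [].
by move=> hs; rewrite eval_heap_free ?hf.
Qed.

Notation "a ;; b" := (SSeq a b) (at level 70, right associativity).

Lemma eval_seq b s1 s2 sg : eval b (s1 ;; s2) sg = eval b s2 (eval b s1 sg).
Proof. by case: sg. Qed.

Lemma eval_if b x s sg : eval b (SIf x s) sg = if sg.1 x == 0 then sg else eval b s sg.
Proof. by case: sg. Qed.

(* Variables: 0 s, 1 t, 2 n, 3 m, 4 k, 5 one, 6 two, 7 B, 8 zero, 9 K, 10 M = B^K, 11 Z (a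
   loop bound exceeding every number that is divided), 12 .. 16 the starts of the output bits
   of vertices and of edges, of the forward and backward marks, and of the potentials; 17, 18,
   19 number, base and position of the digit computed in 20; 28 a vertex, 29 its potential,
   38 an edge, 40 the guess. *)
Record setting := Setting {
  gn : nat; gE : seq (nat * nat); gs : nat; gt : nat; gk : nat; gB : nat; gb : nat }.

Definition gm G := size (gE G).
Definition gK G := gk G + 2 ^ gk G.
Definition gM G := gB G ^ gK G.
Definition gZ G := gM G + gn G + gK G + gB G.
(** Heap addresses omit the offset 5, so [outV] and [outE] are the output cells that
    [output_correct] prescribes. *)
Definition outV G v := 2 * gm G + v.
Definition outE G i := 2 * gm G + gn G + i.
Definition fwd G v := 3 * gm G + gn G + v.
Definition bwd G v := 3 * gm G + 2 * gn G + v.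
Definition pot G v := 3 * gm G + 3 * gn G + v.

Definition const_table G :=
  [:: gs G; gt G; gn G; gm G; gk G; 1; 2; gB G; 0; gK G; gM G; gZ G;
      outV G 0; outE G 0; fwd G 0; bwd G 0; pot G 0].

Definition consts G (v : memory) := forall x, x < 17 -> v x = nth 0 (const_table G) x.

Lemma constsE G v : consts G v ->
  ((v 0 = gs G) * (v 1 = gt G) * (v 2 = gn G) * (v 3 = gm G) * (v 4 = gk G) *
   (v 5 = 1) * (v 6 = 2) * (v 7 = gB G) * (v 8 = 0) * (v 9 = gK G) * (v 10 = gM G) *
   (v 11 = gZ G) * (v 12 = outV G 0) * (v 13 = outE G 0) * (v 14 = fwd G 0) *
   (v 15 = bwd G 0) * (v 16 = pot G 0))%type.
Proof. by move=> cv; do !split; rewrite cv. Qed.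

Lemma consts_frame G ws (v v' : memory) : all (leq 17) ws -> consts G v ->
  (forall y, y \notin ws -> v' y = v y) -> consts G v'.
Proof.
move=> /allP ws17 cv fr x x17; rewrite fr ?cv //.
by apply/negP => /ws17; rewrite leqNgt x17.
Qed.

Lemma consts_eval G b s sg : all (leq 17) (writes s) -> consts G sg.1 ->
  consts G (eval b s sg).1.
Proof. by move=> ws /(consts_frame ws); apply=> y; apply: eval_frame. Qed.

Lemma consts_upd G v x a : 17 <= x -> consts G v -> consts G (upd v x a).
Proof. by move=> x17 cv y y17; rewrite updE ifN ?cv //; apply/eqP; lia. Qed.

(** The bound [wfb] places the whole heap below the variables: 2m input cells, n + m output cells
    and 3n working cells, shifted by 5. *)
Record wf G : Prop := Wf {
  wfE : all (fun e => (e.1 < gn G) && (e.2 < gn G)) (gE G);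
  wfs : gs G < gn G; wft : gt G < gn G; wfst : gs G <> gt G; wfk : 0 < gk G;
  wfB : gk G < gB G; wfnB : gn G <= 2 ^ gB G;
  wfb : 3 * gm G + 4 * gn G + 5 <= gb G }.

(** * Division, digits and potentials by counting *)

Definition div_prog : stmt :=
  SConst 20 0 ;; SConst 21 0 ;;
  SFor 24 11 (SIf 17 (SSub 17 17 5 ;; SAdd 20 20 5 ;; SSub 22 18 20 ;; SSub 23 5 22 ;;
                      SIf 23 (SConst 20 0 ;; SAdd 21 21 5))) ;;
  SAdd 17 21 8.

(** Units move from 17 to the remainder in 20, which is reset, with a carry into the quotient in 21,
    once it reaches d. Equality is tested by truncated subtraction: 1 - (d - r) is nonzero exactly
    when r has reached d. *)
Lemma div_prog_spec G sg : consts G sg.1 -> 0 < sg.1 18 -> sg.1 17 <= gZ G ->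
  (eval (gb G) div_prog sg).1 17 = sg.1 17 %/ sg.1 18 /\
  (eval (gb G) div_prog sg).1 20 = sg.1 17 %% sg.1 18.
Proof.
set a := sg.1 17; set d := sg.1 18 => cv d0 aZ.
rewrite /div_prog 3!eval_seq.
set sg0 := eval _ _ (eval _ _ sg).
have c0 : consts G sg0.1 by do 2 apply: consts_eval => //.
have [a0 d1 q0 r0] : [/\ sg0.1 17 = a, sg0.1 18 = d, sg0.1 21 = 0 & sg0.1 20 = 0].
  by rewrite /sg0 /a /d; case: sg {cv a d d0 aZ sg0 c0}.
pose I j (tau : state) := [/\ tau.1 17 + tau.1 21 * d + tau.1 20 = a, tau.1 20 < d & tau.1 17 <= j].
set loop := SFor _ _ _.
have : I 0 (eval (gb G) loop sg0).
  apply: for_rule.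
    by rewrite /I (constsE c0) /= /upd /= a0 q0 r0 mul0n !addn0; split.
  move=> j [w h'] _ /= fr _ [] /= e1 e2 e3.
  have cw : consts G w.
    exact: consts_frame c0 fr.
  have w18 : w 18 = d by rewrite fr.
  rewrite /I /= /upd /= w18 !(constsE cw).
  case: eqP => /= w0; first by split=> //; lia.
  case: eqP => /= ?; split; lia.
have cl : consts G (eval (gb G) loop sg0).1 by apply: consts_eval => //.
case: (eval _ loop sg0) cl => w h' /= cw [] /= e1 e2 e3.
rewrite /= /upd /= (constsE cw) addn0 -e1.
have -> : w 17 = 0 by lia.
by rewrite add0n divnMDl // modnMDl divn_small // modn_small // addn0.
Qed.

Opaque div_prog.
(** The loop bound must be an unassigned variable, so the loop runs Z times and the test on the
    digit position makes the surplus rounds idle. The last division yields the digit as its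
    remainder. *)
Definition digit_prog : stmt :=
  SFor 25 11 (SIf 19 (SSub 19 19 5 ;; div_prog)) ;; div_prog.

Lemma digit_prog_spec G sg : consts G sg.1 -> 0 < sg.1 18 -> sg.1 17 <= gZ G ->
  sg.1 19 <= gZ G ->
  (eval (gb G) digit_prog sg).1 20 = digit (sg.1 18) (sg.1 19) (sg.1 17).
Proof.
set a := sg.1 17; set d := sg.1 18; set i := sg.1 19 => cv d0 aZ iZ.
rewrite /digit_prog eval_seq.
pose I j (tau : state) := [/\ digit d (tau.1 19) (tau.1 17) = digit d i a, tau.1 17 <= gZ G
  & tau.1 19 <= j].
set loop := SFor _ _ _.
have : I 0 (eval (gb G) loop sg).
  apply: for_rule; first by rewrite /I (constsE cv) /= /upd /=.
  move=> j [w h'] _ fr _; rewrite /I => -[]; rewrite [(_, _).1]/= => e1 e2 e3.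
  have cw : consts G w by apply: consts_frame cv fr; vm_compute.
  have w18 : w 18 = d by apply: fr; vm_compute.
  rewrite eval_if (_ : (upd w 25 j, h').1 19 = w 19) //.
  case: eqP => w0; first by rewrite /upd /=; split=> //; lia.
  rewrite eval_seq; set tau1 := eval _ (SSub _ _ _) _.
  have c1 : consts G tau1.1 by do 2 (apply: consts_eval || apply: consts_upd) => //.
  have [f17 f18 f19] : [/\ tau1.1 17 = w 17, tau1.1 18 = d & tau1.1 19 = w 19 - 1].
    by rewrite /tau1 /= /upd /= (constsE cw).
  have [||g17 _] := div_prog_spec c1; rewrite ?f18 ?f17 //.
  have fr1 y : y \notin writes div_prog -> (eval (gb G) div_prog tau1).1 y = tau1.1 y.
    exact: eval_frame.
  split.
  - rewrite g17 f17 f18 fr1 ?f19 //; rewrite -e1; case: (w 19) w0 => // w19 _.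
    by rewrite digitS subn1.
  - by rewrite g17 f17; apply: leq_trans (leq_div _ _) e2.
  - by rewrite fr1 ?f19 //; lia.
have cl : consts G (eval (gb G) loop sg).1 by apply: consts_eval => //; vm_compute.
have d1 : (eval (gb G) loop sg).1 18 = d by rewrite eval_frame //; vm_compute.
case=> e1 e2 e3; have [|//|_ ->] := div_prog_spec cl; rewrite ?d1 //.
rewrite -e1; move: e3; rewrite leqn0 => /eqP ->.
by rewrite /digit expn0 divn1.
Qed.

Opaque digit_prog.

Definition potential_prog : stmt :=
  SConst 26 0 ;;
  SFor 27 4 (SAdd 17 40 8 ;; SAdd 18 7 8 ;; SAdd 19 27 8 ;; digit_prog ;;
             SAdd 19 20 8 ;; SAdd 17 28 8 ;; SAdd 18 6 8 ;; digit_prog ;;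
             SAdd 26 26 26 ;; SAdd 26 26 20) ;;
  SAdd 17 40 8 ;; SAdd 18 7 8 ;; SAdd 19 4 26 ;; digit_prog ;;
  SSub 29 4 20.

(** Levels rise along a guessed path, so their complements descend. Truncation sends digits above k
    to 0, hence every guess, sensible or not, yields values in {0, ..., k}. *)
Definition potential G N v := gk G - level (gB G) (gk G) N v.

Lemma gK_gt G : gk G < gK G.
Proof. by rewrite /gK -[X in X < _]addn0 ltn_add2l expn_gt0. Qed.

Lemma potential_prog_spec G sg : wf G -> consts G sg.1 -> sg.1 28 < gn G -> sg.1 40 < gM G ->
  (eval (gb G) potential_prog sg).1 29 = potential G (sg.1 40) (sg.1 28).
Proof.
set v := sg.1 28; set N := sg.1 40 => wfG cv vn NM.
have B0 : 0 < gB G by apply: leq_ltn_trans (wfB wfG).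
rewrite /potential_prog 2!eval_seq; set sg0 := eval _ (SConst _ _) _.
have c0 : consts G sg0.1 by apply: consts_eval.
have [v0 N0 h0] : [/\ sg0.1 28 = v, sg0.1 40 = N & sg0.1 26 = 0].
  by rewrite /sg0 /v /N; case: sg {cv v N vn NM sg0 c0}.
pose ws := mkseq (fun j => digit (gB G) j N) (gk G).
pose I j (tau : state) := tau.1 26 = bit_hash (drop j ws) v.
set loop := SFor _ _ _.
have : I 0 (eval (gb G) loop sg0).
  apply: for_rule; first by rewrite /I (constsE c0) /= /upd /= drop_oversize ?size_mkseq.
  rewrite (constsE c0) => j [w h'] jk fr _; rewrite /I [(_, _).1]/= => e1.
  have cw : consts G w by apply: consts_frame c0 fr; vm_compute.
  have w28 : w 28 = v by rewrite -v0; apply: fr; vm_compute.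
  have w40 : w 40 = N by rewrite -N0; apply: fr; vm_compute.
  rewrite 4!eval_seq; set t1 := eval _ (SAdd 19 _ _) _.
  have cu : consts G (upd w 27 j) by apply: consts_upd.
  have c1 : consts G t1.1 by do 3 apply: consts_eval => //.
  have [p17 p18 p19] : [/\ t1.1 17 = N, t1.1 18 = gB G & t1.1 19 = j].
    by rewrite /t1 /= /upd /= !(constsE cw) w40 !addn0.
  have [p28 p26] : t1.1 28 = v /\ t1.1 26 = bit_hash (drop j.+1 ws) v.
    by rewrite /t1 /= /upd /= e1.
  have ZN : N <= gZ G by rewrite /gZ; lia.
  have Zj : j <= gZ G by have := gK_gt G; rewrite /gZ; lia.
  rewrite eval_seq; set t2 := eval _ digit_prog _.
  have c2 : consts G t2.1 by apply: consts_eval => //; vm_compute.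
  have q20 : t2.1 20 = digit (gB G) j N by rewrite digit_prog_spec ?p17 ?p18 ?p19.
  have q28 : t2.1 28 = v by rewrite -p28; apply: eval_frame; vm_compute.
  have q26 : t2.1 26 = t1.1 26 by apply: eval_frame; vm_compute.
  rewrite p26 in q26.
  have qB : digit (gB G) j N <= gZ G by have := ltn_digit j N B0; rewrite /gZ; lia.
  rewrite 3!eval_seq; set t3 := eval _ (SAdd 18 _ _) _.
  have c3 : consts G t3.1 by do 3 apply: consts_eval => //.
  have [r17 r18 r19 r26] : [/\ t3.1 17 = v, t3.1 18 = 2, t3.1 19 = digit (gB G) j N &
      t3.1 26 = bit_hash (drop j.+1 ws) v].
    rewrite /t3; case: (t2) c2 q20 q28 q26 => w2 h2 /= c2 q20 q28 q26.
    by rewrite /upd /= !(constsE c2) q20 q28 !addn0.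
  rewrite eval_seq; set t4 := eval _ digit_prog _.
  have s20 : t4.1 20 = digit 2 (digit (gB G) j N) v.
    by rewrite digit_prog_spec ?r17 ?r18 ?r19 //; rewrite /gZ; lia.
  have s26 : t4.1 26 = t3.1 26 by apply: eval_frame; vm_compute.
  rewrite r26 in s26.
  case: (t4) s20 s26 => w4 h4 /= s20 s26; rewrite /upd /= s20 s26.
  by rewrite [drop j ws](drop_nth 0) ?size_mkseq //= [nth 0 ws j]nth_mkseq.
have cl : consts G (eval (gb G) loop sg0).1 by apply: consts_eval => //; vm_compute.
have [l28 l40] : (eval (gb G) loop sg0).1 28 = v /\ (eval (gb G) loop sg0).1 40 = N.
  by rewrite -v0 -N0; split; apply: eval_frame; vm_compute.
rewrite /I drop0 => l26.
rewrite 4!eval_seq; set t1 := eval _ (SAdd 19 _ _) _.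
have c1 : consts G t1.1 by do 3 apply: consts_eval => //.
have [r17 r18 r19] : [/\ t1.1 17 = N, t1.1 18 = gB G & t1.1 19 = gk G + bit_hash ws v].
  rewrite /t1; case: (eval _ loop _) cl l28 l40 l26 => w2 h2 /= c2 q28 q40 q26.
  by rewrite /upd /= !(constsE c2) q40 q26 !addn0.
have hs : bit_hash ws v < 2 ^ gk G
  by rewrite -[X in 2 ^ X](size_mkseq (fun j => digit (gB G) j N)) bit_hash_lt.
have := digit_prog_spec c1; rewrite r17 r18 r19.
set t2 := eval _ digit_prog _ => e2.
have c2 : consts G t2.1 by apply: consts_eval => //; vm_compute.
rewrite /potential /level -/ws -e2 //; try by rewrite /gZ /gK; lia.
by case: (t2) c2 => w2 h2 /= c2; rewrite /upd /= (constsE c2).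
Qed.

Opaque potential_prog.

(** * Working on one guess: resetting the marks and relaxing an edge *)

Definition reset_prog : stmt :=
  SFor 28 2 (potential_prog ;;
             SAdd 30 16 28 ;; SStore 30 29 ;;
             SAdd 30 14 28 ;; SStore 30 8 ;;
             SAdd 30 15 28 ;; SStore 30 8) ;;
  SAdd 30 14 0 ;; SStore 30 5 ;; SAdd 30 15 1 ;; SStore 30 5.

Lemma eval_store b x y sg : 5 + sg.1 x < b ->
  eval b (SStore x y) sg = (sg.1, upd sg.2 (sg.1 x) (sg.1 y)).
Proof. by case: sg => v h /= ->. Qed.

Lemma eval_add b x y z sg : eval b (SAdd x y z) sg = (upd sg.1 x (sg.1 y + sg.1 z), sg.2).
Proof. by case: sg. Qed.

(** The last clause protects the input and lets the output bits accumulate over the guesses: both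
    lie below [fwd G 0]. *)
Lemma reset_prog_spec G N sg (h' := (eval (gb G) reset_prog sg).2) :
  wf G -> consts G sg.1 -> sg.1 40 = N -> N < gM G ->
  [/\ forall v, v < gn G -> h' (pot G v) = potential G N v,
      forall v, v < gn G -> h' (fwd G v) = (v == gs G),
      forall v, v < gn G -> h' (bwd G v) = (v == gt G) &
      forall a, a < fwd G 0 -> h' a = sg.2 a].
Proof.
rewrite {}/h' => wfG cv vN NM; have wb := wfb wfG.
pose I j (tau : state) :=
  [/\ forall v, j <= v < gn G -> tau.2 (pot G v) = potential G N v,
      forall v, j <= v < gn G -> tau.2 (fwd G v) = 0,
      forall v, j <= v < gn G -> tau.2 (bwd G v) = 0 &
      forall a, a < fwd G 0 -> tau.2 a = sg.2 a].
rewrite /reset_prog eval_seq; set loop := SFor _ _ _.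
have : I 0 (eval (gb G) loop sg).
  apply: for_rule; first by split=> // v /andP [nv /(leq_ltn_trans nv)]; rewrite (constsE cv) ltnn.
  rewrite (constsE cv) => j [w h] jn fr _ IH.
  have cw : consts G w by apply: consts_frame cv fr; vm_compute.
  have w40 : w 40 = N by rewrite -vN; apply: fr; vm_compute.
  rewrite eval_seq; set t1 := eval _ potential_prog _.
  have c1 : consts G t1.1 by apply: consts_eval; [vm_compute | apply: consts_upd].
  have [e28 e29] : t1.1 28 = j /\ t1.1 29 = potential G N j.
    split; first by rewrite eval_frame //; vm_compute.
    by rewrite potential_prog_spec /upd //= ?w40 //; apply: consts_upd.
  have h1 : t1.2 = h by rewrite eval_heap_free //; vm_compute.
  case: (t1) c1 e28 e29 h1 => v1 h' c1.
  rewrite ![(_, _).1]/= in c1 *; rewrite ![(_, _).2]/= => e28 e29 ->.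
  rewrite eval_seq eval_add eval_seq eval_store; last first.
    by rewrite /upd /= !(constsE c1) e28 /pot; lia.
  rewrite eval_seq eval_add eval_seq eval_store; last first.
    by rewrite /upd /= !(constsE c1) e28 /fwd; lia.
  rewrite eval_seq eval_add eval_store; last first.
    by rewrite /upd /= !(constsE c1) e28 /bwd; lia.
  case: IH => i1 i2 i3 i4.
  rewrite /I /upd /= !(constsE c1) e28 e29; rewrite /pot /fwd /bwd in i1 i2 i3 i4 *.
  split=> [v|v|v|a] vj.
  - have [->|] := eqVneq v j; first by rewrite ifF 1?ifF ?ifT //; apply/eqP; lia.
    by move=> ne; rewrite !ifF; [apply: i1; lia|apply/eqP; lia..].
  - have [->|] := eqVneq v j; first by rewrite ifF ?ifT //; apply/eqP; lia.
    by move=> ne; rewrite !ifF; [apply: i2; lia|apply/eqP; lia..].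
  - have [->|] := eqVneq v j; first by rewrite ifT //; apply/eqP; lia.
    by move=> ne; rewrite !ifF; [apply: i3; lia|apply/eqP; lia..].
  - by rewrite !ifF; [apply: i4|apply/eqP; lia..].
have := consts_eval (gb G) (_ : all (leq 17) (writes loop)) cv.
case: (eval _ loop sg) => w h cw [i1 i2 i3 i4]; rewrite /= in i1 i2 i3 i4.
have {}cw : consts G w by apply: cw; vm_compute.
have := wfs wfG; have := wft wfG => tn sn.
rewrite eval_seq eval_add eval_seq eval_store; last by rewrite /upd /= !(constsE cw) /fwd; lia.
rewrite eval_seq eval_add eval_store; last by rewrite /upd /= !(constsE cw) /bwd; lia.
rewrite /upd /= !(constsE cw); rewrite /pot /fwd /bwd in i1 i2 i3 i4 *.
split=> [v vn|v vn|v vn|a an].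
- by rewrite !ifF ?i1 //; apply/eqP; lia.
- rewrite ifF; last by apply/eqP; lia.
  by case: (eqVneq v (gs G)) => [->|ne]; [rewrite ifT // | rewrite ifF ?i2 //]; apply/eqP; lia.
- case: (eqVneq v (gt G)) => [->|ne]; [rewrite ifT // | rewrite !ifF ?i3 //]; apply/eqP; lia.
- by rewrite !ifF ?i4 //; apply/eqP; lia.
Qed.

Opaque reset_prog.

(** The truncated difference of potentials in 35 is nonzero exactly when the edge descends. A
    forward mark then passes from tail to head and a backward mark from head to tail; a forward mark
    at the tail and a backward mark at the head put the edge into the output. *)
Definition edge_prog : stmt :=
  SAdd 30 38 38 ;; SLoad 31 30 ;; SAdd 30 30 5 ;; SLoad 32 30 ;;
  SAdd 30 16 31 ;; SLoad 33 30 ;; SAdd 30 16 32 ;; SLoad 34 30 ;; SSub 35 33 34 ;;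
  SAdd 30 14 31 ;; SLoad 36 30 ;; SAdd 30 15 32 ;; SLoad 37 30 ;;
  SIf 35
    (SIf 36
       (SAdd 30 14 32 ;; SStore 30 5 ;;
        SIf 37 (SAdd 30 13 38 ;; SStore 30 5 ;; SAdd 30 12 31 ;; SStore 30 5 ;;
                SAdd 30 12 32 ;; SStore 30 5)) ;;
     SIf 37 (SAdd 30 15 31 ;; SStore 30 5)).

Definition mark G (h : memory) i : memory :=
  let: (u, w) := nth (0, 0) (gE G) i in
  if h (pot G u) - h (pot G w) == 0 then h else
  let h1 := if h (fwd G u) == 0 then h else
            let h2 := upd h (fwd G w) 1 in
            if h (bwd G w) == 0 then h2 else
            upd (upd (upd h2 (outE G i) 1) (outV G u) 1) (outV G w) 1 in
  if h (bwd G w) == 0 then h1 else upd h1 (bwd G u) 1.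

Definition edges_stored G (h : memory) := forall i, i < gm G ->
  h (i + i) = (nth (0, 0) (gE G) i).1 /\ h (i + i + 1) = (nth (0, 0) (gE G) i).2.

Lemma nth_edge G i : wf G -> i < gm G ->
  (nth (0, 0) (gE G) i).1 < gn G /\ (nth (0, 0) (gE G) i).2 < gn G.
Proof. by move=> wfG im; apply/andP; apply: (all_nthP (0, 0) (wfE wfG)). Qed.

Lemma eval_fetch b x y r rest v h a : v x + v y = a -> 5 + a < b ->
  eval b (SAdd 30 x y ;; SLoad r 30 ;; rest) (v, h) =
  eval b rest (upd (upd v 30 a) r (h a), h).
Proof. by move=> <- ab; rewrite /= updE eqxx ab. Qed.

Lemma eval_put b x y z rest v h a : v x + v y = a -> 5 + a < b -> z != 30 ->
  eval b (SAdd 30 x y ;; SStore 30 z ;; rest) (v, h) =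
  eval b rest (upd v 30 a, upd h a (v z)).
Proof. by move=> <- ab /negPf z30; rewrite /= !updE z30 /= ab. Qed.

Lemma eval_put_last b x y z v h a : v x + v y = a -> 5 + a < b -> z != 30 ->
  eval b (SAdd 30 x y ;; SStore 30 z) (v, h) = (upd v 30 a, upd h a (v z)).
Proof. by move=> <- ab /negPf z30; rewrite /= !updE z30 /= ab. Qed.

Lemma edge_prog_spec G sg : wf G -> consts G sg.1 -> edges_stored G sg.2 -> sg.1 38 < gm G ->
  (eval (gb G) edge_prog sg).2 = mark G sg.2 (sg.1 38).
Proof.
case: sg => v h; set i := (v, h).1 38.
rewrite [(v, h).1]/= [(v, h).2]/= => wfG cv eh im; have wb := wfb wfG.
have [un wn] := nth_edge wfG im; have [hu hw] := eh i im.
rewrite /mark; case: (nth _ _ _) un wn hu hw => u w un wn hu hw; rewrite /= in un wn hu hw.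
have vi : v 38 = i by [].
clearbody i.
rewrite /edge_prog.
rewrite (@eval_fetch _ _ _ _ _ _ _ (i + i)) ?vi //; last by lia.
rewrite hu (@eval_fetch _ _ _ _ _ _ _ (i + i + 1)); first last.
- by lia.
- by rewrite /upd /= (constsE cv).
rewrite hw (@eval_fetch _ _ _ _ _ _ _ (pot G u)); first last.
- by rewrite /pot; lia.
- by rewrite /upd /= !(constsE cv) /pot; lia.
rewrite (@eval_fetch _ _ _ _ _ _ _ (pot G w)); first last.
- by rewrite /pot; lia.
- by rewrite /upd /= !(constsE cv) /pot; lia.
rewrite eval_seq [eval _ (SSub _ _ _) _]/=.
rewrite (@eval_fetch _ _ _ _ _ _ _ (fwd G u)); first last.
- by rewrite /fwd; lia.
- by rewrite /upd /= !(constsE cv) /fwd; lia.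
rewrite (@eval_fetch _ _ _ _ _ _ _ (bwd G w)); first last.
- by rewrite /bwd; lia.
- by rewrite /upd /= !(constsE cv) /bwd; lia.
set v' := upd _ 37 _.
have c' : consts G v' by do ! apply: consts_upd => //.
have [v38 v31 v32] : [/\ v' 38 = i, v' 31 = u & v' 32 = w] by rewrite /v' /upd /= vi.
have [v35 v36 v37] : [/\ v' 35 = h (pot G u) - h (pot G w), v' 36 = h (fwd G u) &
    v' 37 = h (bwd G w)] by [].
move: v' c' v38 v31 v32 v35 v36 v37 => {}v {}cv {}vi v31 v32 v35 v36 v37.
have outEb : 5 + outE G i < gb G by rewrite /outE; lia.
have outub : 5 + outV G u < gb G by rewrite /outV; lia.
have outwb : 5 + outV G w < gb G by rewrite /outV; lia.
have fwdb : 5 + fwd G w < gb G by rewrite /fwd; lia.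
have bwdb : 5 + bwd G u < gb G by rewrite /bwd; lia.
rewrite eval_if [(_, _).1]/= v35; case: ifP => // _.
rewrite eval_seq (eval_if _ 36) [(_, _).1]/= v36.
set h1 := if h (fwd G u) == 0 then h else _.
set sg1 := if _ then (v, h) else _.
have [sg2 c1 [e31 e37]] : [/\ sg1.2 = h1, consts G sg1.1 & sg1.1 31 = u /\ sg1.1 37 = h (bwd G w)].
  rewrite /sg1 /h1; case: ifP => // _.
  rewrite (@eval_put _ _ _ _ _ _ _ (fwd G w)) ?(constsE cv) ?v32 //; last by rewrite /fwd; lia.
  rewrite eval_if (_ : (upd v 30 _, _).1 37 = v 37) // v37; case: ifP => _.
    by split=> //; apply: consts_upd.
  rewrite (@eval_put _ _ _ _ _ _ _ (outE G i)) //; last first.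
    by rewrite /upd /= !(constsE cv) vi /outE; lia.
  rewrite (@eval_put _ _ _ _ _ _ _ (outV G u)) //; last first.
    by rewrite /upd /= !(constsE cv) v31 /outV; lia.
  rewrite (@eval_put_last _ _ _ _ _ _ (outV G w)) //; last by rewrite /upd /= !(constsE cv) v32 /outV; lia.
  split; first by rewrite !updE /= (constsE cv).
    by do ! apply: consts_upd => //.
  by rewrite /= !updE.
rewrite eval_if e37 -sg2; case: ifP => _ //.
case: (sg1) c1 e31 => w1 h2 /= c1 e31.
have -> : bwd G u = bwd G 0 + u by rewrite /bwd; lia.
by rewrite !updE /= !(constsE c1) e31 ifT //; move: bwdb; rewrite /bwd; lia.
Qed.

Opaque edge_prog.

(** * Correctness of the marking rounds *)

Definition descending G N u w :=
  ((u, w) \in gE G) && (potential G N w < potential G N u).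

Lemma descending_size G N x q : path (descending G N) x q ->
  size q + potential G N (last x q) <= potential G N x.
Proof.
elim: q x => [|y q IH] x //= /andP [/andP [_ yx] /IH].
by rewrite addSn => le; apply: leq_ltn_trans le yx.
Qed.

Lemma descending_uniq G N x q : path (descending G N) x q -> uniq (x :: q).
Proof.
move=> px; apply: (@sorted_uniq _ (fun u w => potential G N w < potential G N u)).
- by move=> a b c /= ab bc; apply: ltn_trans bc ab.
- by move=> a; rewrite /= ltnn.
- by apply: sub_path px => u w /andP [].
Qed.

(** The potential of s is at most k and every edge costs at least one unit, which bounds the
    length. *)
Lemma descending_khop G N q : path (descending G N) (gs G) q -> last (gs G) q = gt G ->
  khop_simple_path (gE G) (gk G) (gs G) (gt G) (gs G :: q).
Proof.
move=> pq lq; exists q; split=> //; split; first by apply: sub_path pq => u w /andP [].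
split=> //; split; first exact: descending_uniq pq.
apply: leq_trans (leq_subr _ _ : potential G N (gs G) <= _).
by apply: leq_trans (descending_size pq); rewrite leq_addr.
Qed.

Lemma mem_path_edges x q1 w q2 : (last x q1, w) \in path_edges (x :: q1 ++ w :: q2).
Proof.
rewrite /path_edges; elim: q1 x => [|y q1 IH] x /=; rewrite inE ?eqxx //.
by rewrite IH orbT.
Qed.

Lemma path_edgesP p e : e \in path_edges p ->
  exists2 a, a.+1 < size p & e = (nth 0 p a, nth 0 p a.+1).
Proof.
rewrite /path_edges; case: p => // x q; rewrite /=.
elim: q x => [|y q IH] x //; rewrite inE => /predU1P [->|/IH [a aq ->]]; first by exists 0.
by exists a.+1.
Qed.

(** * Soundness of marks and output bits *)

Record out_sound G (h : memory) : Prop := OutSound {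
  soundV : forall v, v < gn G -> h (outV G v) = 0 \/
    h (outV G v) = 1 /\ in_SPG_V (gE G) (gk G) (gs G) (gt G) v;
  soundE : forall i, i < gm G -> h (outE G i) = 0 \/
    h (outE G i) = 1 /\ in_SPG_E (gE G) (gk G) (gs G) (gt G) (nth (0, 0) (gE G) i) }.

(** Marks certify walks that descend for the current guess only; output bits, which outlive the
    guess, certify membership in the path graph itself. *)
Record good G N (h : memory) : Prop := Good {
  good_edges : edges_stored G h;
  good_pot : forall v, v < gn G -> h (pot G v) = potential G N v;
  good_fwd : forall v, v < gn G -> h (fwd G v) <> 0 ->
    exists2 q, path (descending G N) (gs G) q & last (gs G) q = v;
  good_bwd : forall v, v < gn G -> h (bwd G v) <> 0 ->
    exists2 q, path (descending G N) v q & last v q = gt G;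
  good_out : out_sound G h }.

Definition preserves_ones (h h' : memory) := forall a, h a = 1 -> h' a = 1.

Lemma preserves_ones_upd h a : preserves_ones h (upd h a 1).
Proof. by move=> x hx; rewrite updE; case: eqP. Qed.

Lemma preserves_ones_trans h1 h2 h3 :
  preserves_ones h1 h2 -> preserves_ones h2 h3 -> preserves_ones h1 h3.
Proof. by move=> h12 h23 a /h12 /h23. Qed.

Lemma mark_preserves_ones G h i : preserves_ones h (mark G h i).
Proof.
rewrite /mark; case: (nth (0, 0) _ _) => u w /=.
have R : preserves_ones h h by move=> ?.
have P h' a : preserves_ones h h' -> preserves_ones h (upd h' a 1).
  by move=> hh'; apply: preserves_ones_trans hh' (preserves_ones_upd _).
by repeat first [exact: R | case: ifP => _ | apply: (P)].
Qed.

Lemma good_fwd_upd G N h v : good G N h -> v < gn G ->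
  (exists2 q, path (descending G N) (gs G) q & last (gs G) q = v) ->
  good G N (upd h (fwd G v) 1).
Proof.
case=> g1 g2 g3 g4 [g5 g6] vn rv; split; last split.
- move=> i im; have [e1 e2] := g1 i im; rewrite !updE !ifN ?e1 ?e2 //; apply/eqP; rewrite /fwd; lia.
- by move=> x xn; rewrite updE ifN ?g2 //; apply/eqP; rewrite /fwd /pot; lia.
- move=> x xn; rewrite updE; case: eqP => [e _|_]; last exact: g3.
  by rewrite (_ : x = v) //; move: e; rewrite /fwd; lia.
- by move=> x xn; rewrite updE ifN; [exact: g4|apply/eqP; rewrite /fwd /bwd; lia].
- by move=> x xn; rewrite updE ifN; [exact: g5|apply/eqP; rewrite /fwd /outV; lia].
- by move=> x xn; rewrite updE ifN; [exact: g6|apply/eqP; rewrite /fwd /outE; lia].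
Qed.

Lemma good_bwd_upd G N h v : good G N h -> v < gn G ->
  (exists2 q, path (descending G N) v q & last v q = gt G) ->
  good G N (upd h (bwd G v) 1).
Proof.
case=> g1 g2 g3 g4 [g5 g6] vn rv; split; last split.
- move=> i im; have [e1 e2] := g1 i im; rewrite !updE !ifN ?e1 ?e2 //; apply/eqP; rewrite /bwd; lia.
- by move=> x xn; rewrite updE ifN ?g2 //; apply/eqP; rewrite /bwd /pot; lia.
- by move=> x xn; rewrite updE ifN; [exact: g3|apply/eqP; rewrite /fwd /bwd; lia].
- move=> x xn; rewrite updE; case: eqP => [e _|_]; last exact: g4.
  by rewrite (_ : x = v) //; move: e; rewrite /bwd; lia.
- by move=> x xn; rewrite updE ifN; [exact: g5|apply/eqP; rewrite /bwd /outV; lia].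
- by move=> x xn; rewrite updE ifN; [exact: g6|apply/eqP; rewrite /bwd /outE; lia].
Qed.

Lemma good_outV_upd G N h v : good G N h -> v < gn G ->
  in_SPG_V (gE G) (gk G) (gs G) (gt G) v -> good G N (upd h (outV G v) 1).
Proof.
case=> g1 g2 g3 g4 [g5 g6] vn rv; split; last split.
- move=> i im; have [e1 e2] := g1 i im; rewrite !updE !ifN ?e1 ?e2 //; apply/eqP; rewrite /outV; lia.
- by move=> x xn; rewrite updE ifN ?g2 //; apply/eqP; rewrite /outV /pot; lia.
- by move=> x xn; rewrite updE ifN; [exact: g3|apply/eqP; rewrite /fwd /outV; lia].
- by move=> x xn; rewrite updE ifN; [exact: g4|apply/eqP; rewrite /bwd /outV; lia].
- move=> x xn; rewrite updE; case: eqP => [e|_]; last exact: g5.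
  by right; rewrite (_ : x = v) //; move: e; rewrite /outV; lia.
- by move=> x xn; rewrite updE ifN; [exact: g6|apply/eqP; rewrite /outV /outE; lia].
Qed.

Lemma good_outE_upd G N h i : good G N h -> i < gm G ->
  in_SPG_E (gE G) (gk G) (gs G) (gt G) (nth (0, 0) (gE G) i) -> good G N (upd h (outE G i) 1).
Proof.
case=> g1 g2 g3 g4 [g5 g6] vn rv; split; last split.
- move=> j im; have [e1 e2] := g1 j im; rewrite !updE !ifN ?e1 ?e2 //; apply/eqP; rewrite /outE; lia.
- by move=> x xn; rewrite updE ifN ?g2 //; apply/eqP; rewrite /outE /pot; lia.
- by move=> x xn; rewrite updE ifN; [exact: g3|apply/eqP; rewrite /fwd /outE; lia].
- by move=> x xn; rewrite updE ifN; [exact: g4|apply/eqP; rewrite /bwd /outE; lia].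
- by move=> x xn; rewrite updE ifN; [exact: g5|apply/eqP; rewrite /outE /outV; lia].
- move=> x xn; rewrite updE; case: eqP => [e|_]; last exact: g6.
  by right; rewrite (_ : x = i) //; move: e; rewrite /outE; lia.
Qed.

Lemma mark_good G N h i : wf G -> good G N h -> i < gm G -> good G N (mark G h i).
Proof.
move=> wfG gh im; rewrite /mark.
have [un wn] := nth_edge wfG im.
case E: (nth _ _ _) un wn => [u w] /= un wn.
have uwE : (u, w) \in gE G by rewrite -E mem_nth.
rewrite !(good_pot gh) //; case: ifP => // uw.
have duw : descending G N u w by rewrite /descending uwE; lia.
set fu := h (fwd G u); set bw := h (bwd G w).
have fuP : fu <> 0 -> exists2 q, path (descending G N) (gs G) q & last (gs G) q = u.
  exact: (good_fwd gh).
have bwP : bw <> 0 -> exists2 q, path (descending G N) w q & last w q = gt G.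
  exact: (good_bwd gh).
set h1 := if fu == 0 then h else _.
have g1 : good G N h1.
  rewrite /h1; case: eqP => // /fuP [q1 p1 l1].
  have g2 : good G N (upd h (fwd G w) 1).
    apply: good_fwd_upd => //; exists (rcons q1 w); last by rewrite last_rcons.
    by rewrite rcons_path p1 l1.
  case: eqP => // /bwP [q2 p2 l2].
  (* The forward walk, the edge and the backward walk descend as one walk, so they form a simple
     path within the length bound. *)
  have kp : khop_simple_path (gE G) (gk G) (gs G) (gt G) (gs G :: q1 ++ w :: q2).
    apply: (@descending_khop G N); last by rewrite last_cat.
    by rewrite cat_path p1 /= l1 duw.
  apply: good_outV_upd => //; last first.
    by exists (gs G :: q1 ++ w :: q2); split=> //; rewrite -cat_cons mem_cat mem_head orbT.
  apply: good_outV_upd => //; last first.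
    by exists (gs G :: q1 ++ w :: q2); split=> //; rewrite -cat_cons mem_cat -l1 mem_last.
  apply: good_outE_upd => //.
  exists (gs G :: q1 ++ w :: q2); split=> //.
  by rewrite E -l1 mem_path_edges.
case: eqP => // /bwP [q2 p2 l2]; apply: good_bwd_upd => //.
by exists (w :: q2); rewrite //= duw.
Qed.

(** * Completeness of the marking rounds *)

Definition relaxed G N i (h h' : memory) :=
  let: (u, w) := nth (0, 0) (gE G) i in
  potential G N w < potential G N u ->
  [/\ h (fwd G u) = 1 -> h' (fwd G w) = 1,
      h (bwd G w) = 1 -> h' (bwd G u) = 1 &
      h (fwd G u) = 1 -> h (bwd G w) = 1 ->
        [/\ h' (outE G i) = 1, h' (outV G u) = 1 & h' (outV G w) = 1]].

(** An edge is treated at one moment of a round, but heaps are compared at its start and end. As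
    ones never disappear, progress at that moment extends to the whole round, whatever the order of
    the edges. *)
Lemma relaxed_mono G N i h0 h h' h1 : preserves_ones h0 h -> preserves_ones h' h1 ->
  relaxed G N i h h' -> relaxed G N i h0 h1.
Proof.
rewrite /relaxed; case: (nth (0, 0) _ _) => u w h0h h'h1 rel uw; have [r1 r2 r3] := rel uw.
split=> [/h0h /r1 /h'h1|/h0h /r2 /h'h1|/h0h fu /h0h bw] //.
by have [o1 o2 o3] := r3 fu bw; split; apply: h'h1.
Qed.

Lemma mark_relaxed G N h i : wf G -> good G N h -> i < gm G -> relaxed G N i h (mark G h i).
Proof.
move=> wfG gh im; rewrite /relaxed /mark.
have [un wn] := nth_edge wfG im.
case E: (nth _ _ _) un wn => [u w] /= un wn uw.
rewrite !(good_pot gh) // subn_eq0 leqNgt uw /=.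
have P (h' : memory) a x : h' x = 1 -> upd h' a 1 x = 1 by apply: preserves_ones_upd.
have U (h' : memory) a : upd h' a 1 a = 1 by rewrite updE eqxx.
split=> [->|->|-> ->] //=.
- by repeat first [exact: U | case: ifP => _ | apply: (P)].
- by split; repeat first [exact: U | apply: (P)].
Qed.

Lemma round_spec G N sg (h' := (eval (gb G) (SFor 38 3 edge_prog) sg).2) :
  wf G -> consts G sg.1 -> good G N sg.2 ->
  [/\ good G N h', preserves_ones sg.2 h' & forall i, i < gm G -> relaxed G N i sg.2 h'].
Proof.
rewrite {}/h' => wfG cv gh.
pose I j (tau : state) := [/\ good G N tau.2, preserves_ones sg.2 tau.2 &
  forall i, j <= i < gm G -> relaxed G N i sg.2 tau.2].
apply: (@for_rule I).
  by split=> // i /andP [mi im]; move: (leq_ltn_trans mi im); rewrite (constsE cv) ltnn.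
rewrite (constsE cv) => j [w h] jm fr _ [/= g p r].
have cw : consts G w by apply: consts_frame cv fr; vm_compute.
have e : (eval (gb G) edge_prog (upd w 38 j, h)).2 = mark G h j.
  rewrite edge_prog_spec //=; [exact: consts_upd | exact: good_edges g].
have pm := @mark_preserves_ones G h j.
rewrite /I e; split.
- exact: mark_good.
- exact: preserves_ones_trans pm.
move=> i /andP []; rewrite leq_eqVlt => /predU1P [<- _|ji im].
  exact: relaxed_mono p _ (mark_relaxed wfG g jm).
by apply: relaxed_mono _ pm (r i _) => //; rewrite ji.
Qed.

Definition solution G p := khop_simple_path (gE G) (gk G) (gs G) (gt G) p.

Lemma solution_uniq G p : solution G p -> uniq p.
Proof. by case=> q [_ [_ [_ []]]]. Qed.

Lemma solution_size G p : solution G p -> size p <= (gk G).+1.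
Proof. by case=> q [-> [_ [_ [_]]]]. Qed.

Lemma solution_first G p : solution G p -> nth 0 p 0 = gs G.
Proof. by case=> q [->]. Qed.

Lemma solution_last G p : solution G p -> nth 0 p (size p).-1 = gt G.
Proof. by case=> q [-> [_ [<- _]]]; rewrite nth_last. Qed.

Lemma solution_size_gt1 G p : wf G -> solution G p -> 1 < size p.
Proof. by move=> wfG [[|x q] [-> [_ []]]] // /(wfst wfG). Qed.

Lemma solution_edge G p a : solution G p -> a.+1 < size p ->
  exists2 i, i < gm G & nth (0, 0) (gE G) i = (nth 0 p a, nth 0 p a.+1).
Proof.
case=> q [-> [/(pathP 0) pq _]] aq; have /(nthP (0, 0)) [i iE e] := pq a aq.
by exists i.
Qed.

Lemma solution_lt G p a : wf G -> solution G p -> a < size p -> nth 0 p a < gn G.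
Proof.
move=> wfG sp; case: a => [|a] ap; first by rewrite (solution_first sp) (wfs wfG).
have [i im e] := solution_edge sp ap.
by have [_] := nth_edge wfG im; rewrite e.
Qed.

Definition guessed G N p :=
  solution G p /\ forall a, a < size p -> level (gB G) (gk G) N (nth 0 p a) = a.

Lemma guess_exists G p : wf G -> solution G p -> exists2 N, N < gM G & guessed G N p.
Proof.
move=> wfG sp.
have [|N NM HN] := level_complete (wfB wfG) (solution_uniq sp) (solution_size sp).
  apply/(all_nthP 0) => a ap; apply: leq_trans (wfnB wfG).
  exact: solution_lt ap.
by exists N.
Qed.

Lemma guessed_descends G N p a : guessed G N p -> a.+1 < size p ->
  potential G N (nth 0 p a.+1) < potential G N (nth 0 p a).
Proof.
case=> sp lv ap; rewrite /potential !lv //; last exact: ltnW.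
by have := solution_size sp; lia.
Qed.

Definition marked G (h : memory) p :=
  (forall a, a < size p -> h (outV G (nth 0 p a)) = 1) /\
  (forall i a, i < gm G -> a.+1 < size p ->
     nth (0, 0) (gE G) i = (nth 0 p a, nth 0 p a.+1) -> h (outE G i) = 1).

(** The Bellman-Ford argument from both ends. After r rounds (r = K - j in the invariant) the
    forward marks cover the first r + 1 vertices of a guessed path and the backward marks the last r
    + 1. Output bits rely on the marks of the previous round, and K rounds suffice because a path
    has at most k + 1 <= K vertices. *)
Lemma rounds_spec G N sg (h' := (eval (gb G) (SFor 39 9 (SFor 38 3 edge_prog)) sg).2) :
  wf G -> consts G sg.1 -> good G N sg.2 ->
  sg.2 (fwd G (gs G)) = 1 -> sg.2 (bwd G (gt G)) = 1 ->
  [/\ good G N h', preserves_ones sg.2 h' & forall p, guessed G N p -> marked G h' p].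
Proof.
rewrite {}/h' => wfG cv gh hs ht.
pose I j (tau : state) := [/\ good G N tau.2, preserves_ones sg.2 tau.2 &
  forall p, guessed G N p ->
  [/\ forall a, a < size p -> a + j <= gK G -> tau.2 (fwd G (nth 0 p a)) = 1,
      forall a, a < size p -> (size p).-1 - a + j <= gK G -> tau.2 (bwd G (nth 0 p a)) = 1 &
      size p + j <= gK G -> marked G tau.2 p]].
suff [g pr H] : I 0 (eval (gb G) (SFor 39 9 (SFor 38 3 edge_prog)) sg).
  split=> // p gp; have [_ _] := H p gp; apply.
  rewrite addn0; apply: leq_trans (solution_size gp.1) _; exact: gK_gt.
apply: for_rule; rewrite (constsE cv).
  split=> // p [sp _]; split.
  - by move=> a ap aK; rewrite (_ : a = 0) ?(solution_first sp) //; lia.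
  - move=> a ap aK; rewrite (_ : a = (size p).-1) ?(solution_last sp) //.
    by move: aK; move: (gK G) (size p) ap => x y; lia.
  - by have := solution_size_gt1 wfG sp; move: (gK G) (size p) => x y; lia.
move=> j [w h] jK fr _ [/= g pr H].
have cw : consts G w by apply: consts_frame cv fr; vm_compute.
have := @round_spec G N (upd w 39 j, h) wfG (consts_upd j (isT : 17 <= 39) cw) g.
set tau := eval _ _ _ => -[/= g' pr' rel].
split=> //; first exact: preserves_ones_trans pr'.
move=> p gp; have [Hf Hb _] := H p gp; have [sp _] := gp.
have relp i a : i < gm G -> a.+1 < size p ->
     nth (0, 0) (gE G) i = (nth 0 p a, nth 0 p a.+1) ->
     [/\ h (fwd G (nth 0 p a)) = 1 -> tau.2 (fwd G (nth 0 p a.+1)) = 1,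
         h (bwd G (nth 0 p a.+1)) = 1 -> tau.2 (bwd G (nth 0 p a)) = 1 &
      h (fwd G (nth 0 p a)) = 1 -> h (bwd G (nth 0 p a.+1)) = 1 ->
        [/\ tau.2 (outE G i) = 1, tau.2 (outV G (nth 0 p a)) = 1 & tau.2 (outV G (nth 0 p a.+1)) = 1]].
  by move=> im ap e; have := rel i im; rewrite /relaxed e; apply; apply: guessed_descends.
split.
- case=> [|a] ap aK; first by apply: (pr'); rewrite (solution_first sp); apply: (pr).
  have [i im e] := solution_edge sp ap; have [r1 _ _] := relp i a im ap e.
  by apply: r1; apply: Hf; [apply: ltnW | rewrite addnS].
- move=> a ap aK; have [->|ne] := eqVneq a (size p).-1.
    by apply: (pr'); rewrite (solution_last sp); apply: (pr).
  have ap' : a.+1 < size p by move: (size p) ap ne => y; lia.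
  have [i im e] := solution_edge sp ap'; have [_ r2 _] := relp i a im ap' e.
  by apply: r2; apply: Hb => //; move: (gK G) (size p) ap' aK => x y; lia.
- move=> pK.
  have Hall i a : i < gm G -> a.+1 < size p ->
      nth (0, 0) (gE G) i = (nth 0 p a, nth 0 p a.+1) ->
      [/\ tau.2 (outE G i) = 1, tau.2 (outV G (nth 0 p a)) = 1 & tau.2 (outV G (nth 0 p a.+1)) = 1].
    move=> im ap e; have [_ _ r3] := relp i a im ap e; apply: r3.
      by apply: Hf; [apply: ltnW | move: (gK G) (size p) ap pK => x y; lia].
    by apply: Hb => //; move: (gK G) (size p) ap pK => x y; lia.
  split=> [[|a] ap|i a im ap e].
  + have p1 := solution_size_gt1 wfG sp.
    by have [i im e] := solution_edge sp p1; have [_ ? _] := Hall i 0 im p1 e.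
  + by have [i im e] := solution_edge sp ap; have [_ _ ?] := Hall i a im ap e.
  + by have [? _ _] := Hall i a im ap e.
Qed.

(** * The loop over all guesses *)

Definition main_prog : stmt :=
  SFor 40 10 (reset_prog ;; SFor 39 9 (SFor 38 3 edge_prog)).

Lemma main_prog_spec G sg (h' := (eval (gb G) main_prog sg).2) :
  wf G -> consts G sg.1 -> edges_stored G sg.2 -> out_sound G sg.2 ->
  out_sound G h' /\ forall p, solution G p -> marked G h' p.
Proof.
rewrite {}/h' => wfG cv st os.
pose I j (tau : state) := [/\ edges_stored G tau.2, out_sound G tau.2 &
  forall N p, j <= N < gM G -> guessed G N p -> marked G tau.2 p].
suff [_ os' H] : I 0 (eval (gb G) main_prog sg).
  by split=> // p sp; have [N NM gp] := guess_exists wfG sp; apply: H gp.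
apply: for_rule; rewrite (constsE cv).
  by split=> // N p /andP [MN NM]; move: (leq_ltn_trans MN NM); rewrite ltnn.
move=> N [w h] NM fr _ [ed out H]; rewrite /= in ed out H.
have cw : consts G w by apply: consts_frame cv fr; vm_compute.
have cu : consts G (upd w 40 N) by apply: consts_upd.
rewrite eval_seq; set t1 := eval _ reset_prog _.
have c1 : consts G t1.1 by apply: consts_eval; first by vm_compute.
have [f1 f2 f3 f4] := @reset_prog_spec G N (upd w 40 N, h) wfG cu erefl NM.
rewrite -/t1 [(_, _).2]/= in f1 f2 f3 f4.
have fw0 : fwd G 0 = 3 * gm G + gn G by rewrite /fwd addn0.
have g1 : good G N t1.2.
  split=> //.
  - by move=> i im; have [e1 e2] := ed i im; rewrite !f4 ?e1 ?e2 // fw0; lia.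
  - by move=> v vn; rewrite f2 //; case: eqP => // -> _; exists [::].
  - by move=> v vn; rewrite f3 //; case: eqP => // -> _; exists [::].
  - by split=> [v vn|i im]; rewrite f4 ?fw0 /outV /outE;
      [apply: soundV out _ vn | lia | apply: soundE out _ im | lia].
have [||g2 pr mk] := rounds_spec wfG c1 g1; try by rewrite ?f2 ?f3 ?eqxx ?(wfs wfG) ?(wft wfG).
split; [exact: good_edges g2 | exact: good_out g2 |].
move=> N' p /andP []; rewrite leq_eqVlt => /predU1P [<- _|NN' NM'] gp; first exact: mk.
have [|mV mE] := H N' p _ gp; first by rewrite NN'.
split=> [a ap|i a im ap e]; apply: (pr).
- rewrite f4 ?mV // fw0 /outV; have := solution_lt wfG gp.1 ap.
  by move: (nth _ _ _) => x; lia.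
- by rewrite f4 ?(mE i a) // fw0 /outE; lia.
Qed.

(** * Initialization and running time *)

(** B starts at k + 1 and grows by one whenever the power of two in 41 is doubled on its way up to
    n. The final power is at most 2n, whence 2 ^ B <= n * 2 ^ (k + 2). *)
Definition init_prog1 : stmt :=
  SConst 5 1 ;; SConst 6 2 ;; SConst 8 0 ;; SAdd 7 4 5 ;; SConst 41 1 ;;
  SFor 43 2 (SSub 44 2 41 ;; SIf 44 (SAdd 41 41 41 ;; SAdd 7 7 5)) ;;
  SConst 42 1 ;; SFor 43 4 (SAdd 42 42 42) ;; SAdd 9 4 42.

(** Kept apart from [init_prog1], which assigns 7 and 9, because these are loop bounds here;
    likewise 10 and 11, assigned here, bound loops of [main_prog]. The running time is bounded for
    each of the three pieces with its own list of loop bounds. *)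
Definition init_prog2 : stmt :=
  SConst 10 1 ;;
  SFor 43 9 (SConst 45 0 ;; SFor 44 7 (SAdd 45 45 10) ;; SAdd 10 45 8) ;;
  SAdd 11 10 2 ;; SAdd 11 11 9 ;; SAdd 11 11 7 ;;
  SAdd 12 3 3 ;; SAdd 13 12 2 ;; SAdd 14 13 3 ;; SAdd 15 14 2 ;; SAdd 16 15 2.

Lemma init_prog1_spec b sg (v' := (eval b init_prog1 sg).1) : 0 < sg.1 2 ->
  [/\ v' 5 = 1, v' 6 = 2, v' 8 = 0, v' 9 = sg.1 4 + 2 ^ sg.1 4 &
    [/\ sg.1 4 < v' 7, sg.1 2 <= 2 ^ v' 7 & 2 ^ v' 7 <= sg.1 2 * 2 ^ (sg.1 4).+2]].
Proof.
rewrite {}/v'; set n := sg.1 2; set k := sg.1 4 => n0.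
rewrite /init_prog1 6!eval_seq; set s1 := eval _ (SConst 41 1) _.
have [e5 e6 e8 e7 [e41 e2 e4]] : [/\ s1.1 5 = 1, s1.1 6 = 2, s1.1 8 = 0, s1.1 7 = k.+1 &
    [/\ s1.1 41 = 1, s1.1 2 = n & s1.1 4 = k]].
  by rewrite /s1 /n /k; case: (sg) => v h; rewrite /= /upd /= addn1.
set loop1 := SFor 43 2 _.
(* The last clause shows that n iterations are enough: while below n, variable 41 doubles and so
   grows by at least one. *)
pose I j (tau : state) := [/\ tau.1 41 * 2 ^ k.+1 = 2 ^ tau.1 7, k < tau.1 7,
  tau.1 41 <= 2 * n & n <= tau.1 41 \/ n < tau.1 41 + j].
have : I 0 (eval b loop1 s1).
  apply: for_rule; rewrite e2.
    by rewrite /I /= /upd /= e41 e7 mul1n; split=> //; lia.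
  move=> j [w h] jn fr _ [/= i1 i2 i3 i4].
  have [w2 w5] : w 2 = n /\ w 5 = 1 by split; [rewrite -e2 | rewrite -[RHS]e5]; apply: fr.
  rewrite /I /= /upd /= w2 w5; case: eqP => /= d; first by split=> //; lia.
  split; last by lia.
  - by rewrite addn1 [in RHS]expnS -i1 mulnA mul2n -addnn.
  - by lia.
  - by lia.
set s2 := eval b loop1 s1 => -[i1 i2 i3 i4].
have fr x : x \notin writes loop1 -> s2.1 x = s1.1 x by apply: eval_frame.
rewrite 2!eval_seq; set s3 := eval _ (SConst 42 1) _; set loop2 := SFor 43 4 _.
have fr3 x : x != 42 -> s3.1 x = s2.1 x.
  by move=> /negPf x42; rewrite /s3; case: (s2) => v h; rewrite /= updE x42.
have k3 : s3.1 4 = k by rewrite fr3 // fr.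
pose J j (tau : state) := tau.1 42 * 2 ^ j = 2 ^ k.
have : J 0 (eval b loop2 s3).
  apply: for_rule; rewrite k3.
    by rewrite /J /s3; case: (s2) => v h; rewrite /= /upd /= mul1n.
  by move=> j [w h] _ _ _; rewrite /J /= /upd /= expnS mulnA addnn muln2.
rewrite /J muln1 => e42.
have fr4 x : x \notin writes loop2 -> (eval b loop2 s3).1 x = s3.1 x by apply: eval_frame.
set s4 := eval b loop2 s3 in e42 fr4 *.
have fr5 x : x != 9 -> (eval b (SAdd 9 4 42) s4).1 x = s4.1 x.
  by move=> /negPf x9; case: (s4) => v h; rewrite /= updE x9.
have fr6 x : x \in [:: 5; 6; 7; 8] -> (eval b (SAdd 9 4 42) s4).1 x = s2.1 x.
  by rewrite !inE => /or4P [] /eqP ->; rewrite fr5 // fr4 // fr3.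
rewrite !(fr6 5, fr6 6, fr6 8, fr6 7) // !(fr 5, fr 6, fr 8) //; split=> //.
  by rewrite eval_add /= updE /= e42 fr4 // k3.
split=> //; rewrite -i1; last by rewrite [in X in _ <= X]expnS; nia.
have : 0 < 2 ^ k.+1 by rewrite expn_gt0.
by nia.
Qed.

Lemma init_prog2_spec G sg :
  sg.1 0 = gs G -> sg.1 1 = gt G -> sg.1 2 = gn G -> sg.1 3 = gm G -> sg.1 4 = gk G ->
  sg.1 5 = 1 -> sg.1 6 = 2 -> sg.1 7 = gB G -> sg.1 8 = 0 -> sg.1 9 = gK G ->
  consts G (eval (gb G) init_prog2 sg).1.
Proof.
move=> e0 e1 e2 e3 e4 e5 e6 e7 e8 e9.
rewrite /init_prog2 2!eval_seq; set s1 := eval _ (SConst 10 1) _; set loop := SFor 43 9 _.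
have fr1 x : x != 10 -> s1.1 x = sg.1 x.
  by move=> /negPf x10; rewrite /s1; case: (sg) => v h; rewrite /= updE x10.
pose I j (tau : state) := tau.1 10 * gB G ^ j = gM G.
have : I 0 (eval (gb G) loop s1).
  apply: for_rule; rewrite fr1 // e9.
    by rewrite /I /s1; case: (sg) => v h; rewrite /= /upd /= mul1n.
  move=> j [w h] _ fr _; rewrite /I [(_, _).1]/= => e10.
  have [w7 w8] : w 7 = gB G /\ w 8 = 0 by split; [rewrite -e7 | rewrite -[RHS]e8]; rewrite -fr1 //; apply: fr.
  rewrite 2!eval_seq; set t1 := eval _ (SConst 45 0) _.
  have [f7 f8 f10 f45] : [/\ t1.1 7 = gB G, t1.1 8 = 0, t1.1 10 = w 10 & t1.1 45 = 0].
    by rewrite /t1 /= /upd /=.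
  clearbody t1; pose J i (tau : state) := tau.1 45 + i * w 10 = gB G * w 10.
  set loop' := SFor 44 7 _.
  have : J 0 (eval (gb G) loop' t1).
    apply: for_rule; rewrite f7; first by rewrite /J /= /upd /= f45.
    move=> i [w' h'] _ fr' _; rewrite /J [(_, _).1]/= => e45.
    have w10 : w' 10 = w 10 by rewrite -f10; apply: fr'.
    by rewrite /= /upd /= w10 -e45 mulSn addnA.
  have g8 : (eval (gb G) loop' t1).1 8 = 0 by rewrite eval_frame.
  rewrite /J mul0n addn0; case: (eval _ loop' t1) g8 => w' h' /= g8 e45.
  by rewrite /upd /= g8 e45 addn0 -e10 expnS; lia.
rewrite /I muln1 => e10.
have fr x : x \notin writes loop -> x != 10 -> (eval (gb G) loop s1).1 x = sg.1 x.
  by move=> xl x10; rewrite eval_frame // fr1.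
case: (eval _ loop s1) e10 fr => w h e10 fr x x17; rewrite /= in e10 fr.
have [f2 f3 f7 f9] : [/\ w 2 = gn G, w 3 = gm G, w 7 = gB G & w 9 = gK G].
  by rewrite !fr.
case: x x17 => [|x] x17; first exact: etrans (fr 0 isT isT) e0.
case: x x17 => [|x] x17; first exact: etrans (fr 1 isT isT) e1.
case: x x17 => [|x] x17; first exact: etrans (fr 2 isT isT) e2.
case: x x17 => [|x] x17; first exact: etrans (fr 3 isT isT) e3.
case: x x17 => [|x] x17; first exact: etrans (fr 4 isT isT) e4.
case: x x17 => [|x] x17; first exact: etrans (fr 5 isT isT) e5.
case: x x17 => [|x] x17; first exact: etrans (fr 6 isT isT) e6.
case: x x17 => [|x] x17; first exact: etrans (fr 7 isT isT) e7.
case: x x17 => [|x] x17; first exact: etrans (fr 8 isT isT) e8.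
case: x x17 => [|x] x17; first exact: etrans (fr 9 isT isT) e9.
case: x x17 => [|x] x17; first exact: e10.
case: x x17 => [|x] x17.
  by transitivity (w 10 + w 2 + w 9 + w 7); rewrite // e10 f2 f7 f9.
case: x x17 => [|x] x17.
  by transitivity (w 3 + w 3); rewrite // f3 /= /outV; lia.
case: x x17 => [|x] x17.
  by transitivity (w 3 + w 3 + w 2); rewrite // f2 f3 /= /outE; lia.
case: x x17 => [|x] x17.
  by transitivity (w 3 + w 3 + w 2 + w 3); rewrite // f2 f3 /= /fwd; lia.
case: x x17 => [|x] x17.
  by transitivity (w 3 + w 3 + w 2 + w 3 + w 2); rewrite // f2 f3 /= /bwd; lia.
case: x x17 => [|x] x17.
  by transitivity (w 3 + w 3 + w 2 + w 3 + w 2 + w 2); rewrite // f2 f3 /= /pot; lia.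
by [].
Qed.

Lemma time_poly s : exists A d, forall X, time X s <= A * X.+1 ^ d.
Proof.
have prim : exists A d, forall X, 11 <= A * X.+1 ^ d by exists 11, 0.
elim: s => [r c|r y z|r y z|r y|r y|s1 [A1 [d1 H1]] s2 [A2 [d2 H2]]|r s [A [d H]]|c r s [A [d H]]] //.
- exists (A1 + A2), (d1 + d2) => X /=.
  have p1 : 0 < X.+1 ^ d1 by rewrite expn_gt0.
  have p2 : 0 < X.+1 ^ d2 by rewrite expn_gt0.
  have := H1 X; have := H2 X; rewrite expnD mulnDl => h2 h1; apply: leq_add.
    by apply: leq_trans h1 _; rewrite leq_mul2l leq_pmulr ?orbT.
  by apply: leq_trans h2 _; rewrite leq_mul2l leq_pmull ?orbT.
- exists (4 + A), d => X /=; have := H X; have : 0 < X.+1 ^ d by rewrite expn_gt0.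
  by nia.
- exists (20 + A), d.+1 => X /=; have := H X; rewrite expnS.
  have : 0 < X.+1 ^ d by rewrite expn_gt0.
  by nia.
Qed.

(* Every register holds live input and no address is known to be free. Reversible additions
   first turn register 4 into b = 6k + 3m + 4n, an address beyond the input and the output;
   once s and t are saved there, the additions are undone. *)
Definition shear := [:: IAdd 0 0 4; IAdd 1 1 0; IAdd 4 4 1; IAdd 0 0 4; IAdd 1 1 0; IAdd 4 4 1].
Definition save_st :=
  [:: IStore 4 2; IConst 2 1; IAdd 2 2 4; IStore 2 3; IConst 2 0; IAdd 2 2 4].
Definition unshear :=
  [:: ISub 4 4 1; ISub 1 1 0; ISub 0 0 4; ISub 4 4 1; ISub 1 1 0; ISub 0 0 4].
Definition save_nmk :=
  [:: IConst 3 2; IAdd 3 3 2; IStore 3 0; IConst 3 3; IAdd 3 3 2; IStore 3 1;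
      IConst 3 4; IAdd 3 3 2; IStore 3 4].
Definition prologue := shear ++ save_st ++ unshear ++ save_nmk.

Lemma shear_spec n m s t k M (M' := foldl exec1 M shear) :
  M 0 = n -> M 1 = m -> M 2 = s -> M 3 = t -> M 4 = k ->
  [/\ M' 0 = 3 * k + m + 2 * n, M' 1 = 4 * k + 2 * m + 3 * n, M' 2 = s, M' 3 = t &
    M' 4 = 6 * k + 3 * m + 4 * n /\ forall x, 5 <= x -> M' x = M x].
Proof.
move=> M0 M1 M2 M3 M4; rewrite {}/M' /= /upd /= M0 M1 M2 M3 M4.
split=> //; try lia; split; first by lia.
by do 5 case=> //.
Qed.

Lemma save_st_spec b M (M' := foldl exec1 M save_st) : 5 <= b -> M 4 = b ->
  [/\ M' 0 = M 0, M' 1 = M 1, M' 2 = b, M' 4 = b &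
    [/\ M' b = M 2, M' b.+1 = M 3 & forall x, 5 <= x -> x != b -> x != b.+1 -> M' x = M x]].
Proof.
case: b => [|[|[|[|[|b]]]]] // _ M4.
rewrite {}/M' /= /upd /= M4 add0n add1n /= !eqxx; split=> //; split=> //.
  by rewrite ifN //; apply/eqP; lia.
by do 5 case=> //; move=> x _ /= /negPf -> /negPf ->.
Qed.

Lemma unshear_spec n m k M (b := 6 * k + 3 * m + 4 * n) (M' := foldl exec1 M unshear) :
  M 0 = 3 * k + m + 2 * n -> M 1 = 4 * k + 2 * m + 3 * n -> M 4 = b ->
  [/\ M' 0 = n, M' 1 = m, M' 2 = M 2, M' 4 = k & forall x, 5 <= x -> M' x = M x].
Proof.
move=> M0 M1 M4; rewrite {}/M' /= /upd /= M0 M1 M4 /b; split=> //; try lia.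
by do 5 case=> //.
Qed.

Lemma save_nmk_spec b M (M' := foldl exec1 M save_nmk) : 5 <= b -> M 2 = b ->
  [/\ M' 2 = b, M' (b + 2) = M 0, M' (b + 3) = M 1, M' (b + 4) = M 4 &
    forall x, 5 <= x -> x \notin [:: b + 2; b + 3; b + 4] -> M' x = M x].
Proof.
case: b => [|[|[|[|[|b]]]]] // _ M2.
rewrite {}/M' /= /upd /= M2 /= !addSn !addnS addn0 add0n /= !eqxx; split=> //.
- by rewrite !ifN //; apply/eqP; lia.
- by rewrite !ifN //; apply/eqP; lia.
by do 5 case=> //; move=> x _ /=; rewrite !inE !negb_or => /and3P [/negPf -> /negPf -> /negPf ->].
Qed.

(** Cells from [b] on are blank by hypothesis, which gives every variable but the first five its
    initial value 0. *)
Lemma prologue_spec n m s t k M (b := 6 * k + 3 * m + 4 * n) :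
  0 < k -> M 0 = n -> M 1 = m -> M 2 = s -> M 3 = t -> M 4 = k ->
  (forall i, M (b + i) = 0) ->
  represents b (foldl exec1 M prologue)
    (fun i => nth 0 [:: s; t; n; m; k] i, fun a => M (5 + a)).
Proof.
move=> k0 M0 M1 M2 M3 M4 Mb; have b5 : 5 <= b by rewrite /b; lia.
have := shear_spec M0 M1 M2 M3 M4.
rewrite /prologue !foldl_cat; move: (foldl exec1 M shear) => N1 [a0 a1 a2 a3 [a4 aM]].
have := save_st_spec b5 a4.
move: (foldl exec1 N1 save_st) => N2 [c0 c1 c2 c4 [cs ct cM]].
rewrite a0 in c0; rewrite a1 in c1.
have := unshear_spec c0 c1 c4.
move: (foldl exec1 N2 unshear) => N3 [d0 d1 d2 d4 dM].
rewrite c2 in d2; have := save_nmk_spec b5 d2.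
move: (foldl exec1 N3 save_nmk) => N4 [e2 fn fm fk eM].
clearbody b; split=> [|i|a ab] //=.
  case: i => [|[|[|[|[|i]]]]] /=.
  - by rewrite addn0 eM ?dM ?cs // !inE; lia.
  - by rewrite addn1 eM ?dM ?ct ?a3 // ?inE; lia.
  - by rewrite fn.
  - by rewrite fm.
  - by rewrite fk.
  - by rewrite nth_nil eM ?dM ?cM ?aM ?Mb // ?inE; lia.
by rewrite eM ?dM ?cM ?aM // ?inE; lia.
Qed.

(** * The complete program and its time budget *)

Lemma compile_seq l s1 s2 :
  compile l (s1 ;; s2) = compile l s1 ++ compile (l + size (compile l s1)) s2.
Proof. by []. Qed.

Definition spg_program : program :=
  prologue ++ compile 27 (init_prog1 ;; init_prog2 ;; main_prog).

Lemma nth_enc_edges E i : nth 0 (enc_edges E) (i + i) = (nth (0, 0) E i).1 /\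
  nth 0 (enc_edges E) (i + i + 1) = (nth (0, 0) E i).2.
Proof.
rewrite /enc_edges; elim: E i => [|e E IH] i /=; first by rewrite !nth_nil.
case: i => [|i] //.
by rewrite addSn addnS /= addn1 /= -addn1; apply: IH.
Qed.

(** The left side is one more than the common loop bound. The terms mixing n and k are B ^ K and B,
    and both are controlled through 2 ^ B. *)
Lemma budget_bound n m k B (K := k + 2 ^ k) : 0 < n -> 2 ^ B <= n * 2 ^ k.+2 ->
  (B ^ K + n + K + B + n + m + k).+1 <= (K ^ K * 2 ^ k.+2 + 2 ^ k.+2 + K + k + 3) * (n + m + 1).
Proof.
move=> n0 le; have := exp_le_fpt B K; have := ltn_expl B (isT : 1 < 2).
move: (2 ^ k.+2) (2 ^ B) (B ^ K) (K ^ K) le => p q M KK le Bq Mq.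
have {Mq} : M <= KK * p * n by apply: leq_trans Mq _; rewrite -mulnA leq_mul2l mulnC le orbT.
have {Bq le} : B <= p * n by rewrite mulnC; apply: ltnW; apply: leq_trans Bq le.
have : KK * p * n <= KK * p * (n + m + 1) by rewrite leq_mul2l; lia.
have : p * n <= p * (n + m + 1) by rewrite leq_mul2l; lia.
have : K <= K * (n + m + 1) by rewrite leq_pmulr // addn1.
have : k <= k * (n + m + 1) by rewrite leq_pmulr // addn1.
by rewrite !mulnDl; lia.
Qed.

Lemma size_enc_edges E : size (enc_edges E) = 2 * size E.
Proof. by rewrite /enc_edges; elim: E => //= e E ->; lia. Qed.

Lemma init_mem_input n E s t k a : init_mem n E s t k (5 + a) = nth 0 (enc_edges E) a.
Proof. by rewrite -[in RHS](addKn 5 a). Qed.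

Lemma in_SPG_V_marked G h p v : marked G h p -> v \in p -> h (outV G v) = 1.
Proof. by case=> mV _ /(nthP 0) [a ap <-]; apply: mV. Qed.

Lemma in_SPG_E_marked G h p i : marked G h p -> i < gm G ->
  nth (0, 0) (gE G) i \in path_edges p -> h (outE G i) = 1.
Proof. by case=> _ mE im /path_edgesP [a ap e]; apply: mE e. Qed.

(* Computing SPG_k(s,t) is fixed-parameter tractable in k: some RAM program
   computes it in time f(k) * |input|^c. *)
Theorem theorem2p6 :
  exists (P : program) (f : nat -> nat) (c : nat),
    forall (n : nat) (E : seq (nat * nat)) (s t k : nat),
      valid_instance n E s t k ->
      exists Mf : memory,
        halts_within P (f k * input_size n E ^ c) (0, init_mem n E s t k) Mf /\
        output_correct n E s t k Mf.
Proof.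
have [A [d Hd]] := time_poly (init_prog1 ;; init_prog2 ;; main_prog).
(* 27 is the length of the prologue; the power is taken of the factor in [budget_bound] that depends
   on k alone. *)
exists spg_program, (fun k => let K := k + 2 ^ k in
  (27 + A) * (K ^ K * 2 ^ k.+2 + 2 ^ k.+2 + K + k + 3) ^ d), d.
move=> n E s t k [wE [sn [tn [st k0]]]].
pose m := size E; pose b := 6 * k + 3 * m + 4 * n.
have b5 : 5 <= b by rewrite /b; lia.
have n0 : 0 < n by apply: leq_ltn_trans sn.
pose M0 := init_mem n E s t k.
pose sg0 : state := (fun i => nth 0 [:: s; t; n; m; k] i, fun a => M0 (5 + a)).
have h0 a : sg0.2 a = nth 0 (enc_edges E) a by apply: init_mem_input.
have blank a : 2 * m <= a -> sg0.2 a = 0.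
  by move=> ma; rewrite h0 nth_default // size_enc_edges.
have rep0 : represents b (foldl exec1 M0 prologue) sg0.
  apply: prologue_spec => // i.
  have -> : 6 * k + 3 * m + 4 * n + i = 5 + (b - 5 + i) by rewrite /b; lia.
  apply: blank.
  by rewrite /b; lia.
set sg1 := eval b init_prog1 sg0.
have [v5 v6 v8 v9 [kB nB Bn]] := init_prog1_spec b (n0 : 0 < sg0.1 2).
have fr1 x : x < 5 -> sg1.1 x = sg0.1 x.
  by move=> x5; apply: eval_frame; do 5 (case: x x5 => [|x] x5 //).
rewrite -[sg0.1 4]/k -[sg0.1 2]/n in v9 kB nB Bn.
(* The base is whatever [init_prog1] left in variable 7; only the inequalities about it matter. *)
pose G := Setting n E s t k (sg1.1 7) b.
have wfG : wf G by split=> //; rewrite /b /gm /=; lia.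
set sg2 := eval b init_prog2 sg1.
have c2 : consts G sg2.1 by apply: (@init_prog2_spec G sg1) => //; rewrite fr1.
have h2 : sg2.2 = sg0.2 by rewrite /sg2 eval_heap_free // /sg1 eval_heap_free.
set sg3 := eval b main_prog sg2.
have [||os3 mk3] := main_prog_spec wfG c2.
- by move=> i im; rewrite h2 !h0; apply: nth_enc_edges.
- by split=> [v vn|i im]; left; rewrite h2 blank // /outV /outE /gm /= -/m; lia.
rewrite -/sg3 in os3 mk3.
pose X := gZ G + gn G + gm G + gk G.
have [c0] := code_at_cat (code_at_self (prologue ++ _) : code_at spg_program 0 _).
rewrite (compile_seq _ init_prog1) (compile_seq _ init_prog2 main_prog).
case/code_at_cat=> c1 /code_at_cat [c3 c4].
have r0 := reach_straight M0 c0 isT.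
have [|M1 r1 rep1] := compile_correct b5 (isT : loops_over [:: 2; 4] init_prog1) c1 rep0 (X := X).
  by move=> x; rewrite !inE => /orP [] /eqP ->;
    [rewrite -[_.1 _]/(gn G) | rewrite -[_.1 _]/(gk G)]; rewrite /X; lia.
have [|M2 r2 rep2] := compile_correct b5 (isT : loops_over [:: 9; 7] init_prog2) c3 rep1 (X := X).
  move=> x; rewrite !inE => /orP [] /eqP ->; last by rewrite -[sg1.1 7]/(gB G) /X /gZ; lia.
  by rewrite v9 -[_ + _]/(gK G) /X /gZ; lia.
have lo : loops_over [:: 10; 2; 4; 11; 9; 3] main_prog by vm_compute.
have [|M3 r3 rep3] := compile_correct b5 lo c4 rep2 (X := X).
  move=> x xs; have x17 : x < 17 by move: x xs; apply/allP.
  rewrite c2 //; move: xs; rewrite !inE.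
  case/orP=> [/eqP ->|]; first by rewrite -[nth _ _ _]/(gM G) /X /gZ; lia.
  case/orP=> [/eqP ->|]; first by rewrite -[nth _ _ _]/(gn G) /X; lia.
  case/orP=> [/eqP ->|]; first by rewrite -[nth _ _ _]/(gk G) /X; lia.
  case/orP=> [/eqP ->|]; first by rewrite -[nth _ _ _]/(gZ G) /X; lia.
  case/orP=> [/eqP ->|/eqP ->]; first by rewrite -[nth _ _ _]/(gK G) /X /gZ; lia.
  by rewrite -[nth _ _ _]/(gm G) /X; lia.
exists M3; split.
  have [j jT rj] := reach_trans r0 (reach_trans r1 (reach_trans r2 r3)).
  (* [IHalt] is never compiled: the run ends at the address just past the program. *)
  exists j, (size spg_program); split.
    apply: leq_trans jT _; have := budget_bound m n0 Bn; rewrite -[(_ + _ + m + k).+1]/X.+1 => HX.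
    apply: leq_trans (_ : (27 + A) * X.+1 ^ d <= _).
      rewrite mulnDl; apply: leq_add (Hd X).
      by rewrite -[size _]/27 leq_pmulr // expn_gt0.
    rewrite -mulnA leq_mul2l -expnMn /input_size -/m; apply/orP; right.
    by case: (d) => [|d'] //; rewrite leq_exp2r // HX.
  split; last by rewrite /step ltnn.
  by rewrite rj add0n (_ : size prologue = 27).
have out a : 5 + a < b -> M3 (5 + a) = sg3.2 a by case: rep3 => _ _; apply.
split=> [v vn|i im].
  rewrite -addnA out; last by rewrite /b -/m; lia.
  split=> [[p [sp vp]]|nin]; first exact: in_SPG_V_marked (mk3 p sp) vp.
  (* Since soundness says that the bit is 0 or else 1 with a witness, a vertex outside the path
     graph gets 0 without membership being decided. *)
  by case: (soundV os3 vn) => [|[_ /nin]].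
rewrite -2!addnA (addnA (2 * _)) out; last by rewrite /b -/m; lia.
split=> [[p [sp ep]]|nin]; first exact: in_SPG_E_marked (mk3 p sp) im ep.
by case: (soundE os3 im) => [|[_ /nin]].
Qed.
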